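(* Let $u,w\in S_n$ and $q^\alpha w\in S_n[q]$ be such that $[u,q^\alpha w]_k^q$ is a minimal interval. Then there is a hook partition $\lambda$ with $|\lambda|=\ell(q^\alpha w)-\ell(u)$ such that $C^{q^\alpha w}_{u,v(\lambda,k)}$ is nonzero.
   Context: Here $1\le k<n$, $S_n$ is the symmetric group, permutations are composed as functions, $(i,j)$ is a transposition, $\mathbb{N}=\{0,1,2,\dots\}$, and $\ell(u)=\#\{i<j\mid u(i)>u(j)\}$ for $u\in S_n$. $\mathbb{Z}[q]=\mathbb{Z}[q_1,\dots,q_{n-1}]$; $q^\alpha=q_1^{\alpha_1}\cdots q_{n-1}^{\alpha_{n-1}}$ for $\alpha\in\mathbb{N}^{n-1}$; and $q_{i,j}=q_iq_{i+1}\cdots q_{j-1}$ for $i<j$. $qH^*\mathbb{F}\ell_n$ is the small quantum cohomology ring of the manifold of complete flags in $\mathbb{C}^n$: it is a commutative associative $\mathbb{Z}[q]$-algebra, free as a $\mathbb{Z}[q]$-module with basis the Schubert classes $\{\mathfrak{S}_w\}_{w\in S_n}$, whose product $\ast$ is determined by the quantum Monk formula: for $u\in S_n$ and $1\le k<n$, $$\mathfrak{S}_u*\mathfrak{S}_{(k,k+1)}=\sum_{\substack{1\le i\le k<j\le n\\ \ell(u)+1=\ell(u(i,j))}}\mathfrak{S}_{u(i,j)}+\sum_{\substack{1\le i\le k<j\le n\\ \ell(u)+1=\ell(u(i,j))+2(j-i)}}q_{i,j}\,\mathfrak{S}_{u(i,j)}\,.$$ The hook partition $(b,1^{a-1})$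 is the partition of $a+b-1$ into $a$ parts, the first of size $b$ and the remaining all of size $1$. For a partition $\lambda=(\lambda_1\ge\dots\ge\lambda_k\ge0)$ with $\lambda_1\le n-k$, $v(\lambda,k)\in S_n$ is the permutation with $v(i)=i+\lambda_{k+1-i}$ for $i\le k$ and $v(k+1)<\dots<v(n)$. The quantum Littlewood–Richardson coefficients $C^{q^\alpha w}_{u,v(\lambda,k)}\in q^\alpha\mathbb{N}$ are defined by $\mathfrak{S}_u*\mathfrak{S}_{v(\lambda,k)}=\sum_{q^\alpha w\in S_n[q]}C^{q^\alpha w}_{u,v(\lambda,k)}\mathfrak{S}_w$. The quantum $k$-Bruhat order $\le_k^q$ on $S_n[q]=\{q^\alpha u\mid u\in S_n,\ \alpha\in\mathbb{N}^{n-1}\}$ is the partial order defined by the covers $u\lessdot_k^q u(i,j)$ if $i\le k<j$ and $\ell(u)+1=\ell(u(i,j))$, and $u\lessdot_k^q q_{i,j}u(i,j)$ if $i\le k<j$ and $\ell(u)+1=\ell(u(i,j))+2(j-i)$, extended $q$-multiplicatively ($u\le_k^q q^\beta w$ if and only if $q^\alpha u\le^q_k q^{\alpha+\beta}w$). It is ranked by $\ell(q^\alpha u)=2\sum_i\alpha_i+\ell(u)$. For $u\le_k^q q^\alpha w$, $[u,q^\alpha w]_k^q$ denotes the interval in this order; it is minimal if its rank $\ell(q^\alpha w)-\ell(u)$ equals $\#\mathrm{supp}(wu^{-1})-s(wu^{-1})$, where $\mathrm{supp}(\zeta)=\{i\mid\zeta(i)\ne i\}$ and $s(\zeta)$ is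 the number of nontrivial cycles of $\zeta$. *)

(* Defs.v *)
From HB Require Import structures.
From Stdlib Require Import Relation_Operators.
From mathcomp Require Import all_boot all_order all_algebra all_fingroup.
From mathcomp Require Import mpoly.

Set Implicit Arguments.
Unset Strict Implicit.
Unset Printing Implicit Defensive.

Import GRing.Theory.

(* The set {1, ..., n} is represented by 'I_n = {0, ..., n-1}, and the variable
   q_i (1 <= i < n) by the variable of 0-based index i - 1.  Thus the condition
   1 <= i <= k < j <= n on positions becomes  i < k <= j  on 'I_n. *)

(* In {perm T} the product is (s * t) x = t (s x), whereas permutations are
   composed here as functions; fmul u v is u o v. *)
Definition fmul (T : finType) (u v : {perm T}) : {perm T} := (v * u)%g.

Lemma fmulE (T : finType) (u v : {perm T}) x : fmul u v x = u (v x).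
Proof. by rewrite permM. Qed.

Definition plen (n : nat) (u : 'S_n) : nat :=
  #|[set p : 'I_n * 'I_n | (p.1 < p.2) && (u p.2 < u p.1)]|.

(* q_{i,j} = q_i ... q_{j-1}, as an exponent. *)
Definition qexp (n : nat) (i j : 'I_n) : 'X_{1..n.-1} :=
  [multinom (i <= m < j : nat) | m < n.-1].

Section QuantumCohomology.

Local Open Scope ring_scope.

Definition Zq (n : nat) := {mpoly int[n.-1]}.

(* The index k is carried by its two neighbouring positions: in 0-based
   notation the transposition (k, k+1) is tperm k0 k1 with k1 = k0 + 1 = k. *)
Definition quantum_monk (n : nat) (A : comAlgType (Zq n)) (S : 'S_n -> A) :=
  forall (u : 'S_n) (k0 k1 : 'I_n), k1 = k0.+1 :> nat ->
    S u * S (tperm k0 k1) =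
      \sum_(p : 'I_n * 'I_n | [&& (p.1 < k1)%N, (k1 <= p.2)%N &
             ((plen u).+1 == plen (fmul u (tperm p.1 p.2)))%N])
         S (fmul u (tperm p.1 p.2))
    + \sum_(p : 'I_n * 'I_n | [&& (p.1 < k1)%N, (k1 <= p.2)%N &
             ((plen u).+1 ==
                plen (fmul u (tperm p.1 p.2)) + 2 * (p.2 - p.1))%N])
         ('X_[qexp p.1 p.2] : Zq n) *: S (fmul u (tperm p.1 p.2)).

(* The small quantum cohomology ring of the flag manifold of C^n, presented by
   the data that characterize it: a commutative Z[q]-algebra, free on Schubert
   classes indexed by S_n, whose product satisfies the quantum Monk formula. *)
Record qH_flag (n : nat) := QHFlag {
  qH_ring :> comAlgType (Zq n);
  schubert : 'S_n -> qH_ring;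
  schubert_basis : forall x : qH_ring, exists! c : {ffun 'S_n -> Zq n},
    x = \sum_(w : 'S_n) c w *: schubert w;
  schubert_monk : quantum_monk schubert
}.

Arguments schubert {n A} w : rename.

Lemma coord_subproof (n : nat) (A : qH_flag n) (x : A) :
  exists c : {ffun 'S_n -> Zq n},
    x == \sum_(w : 'S_n) c w *: (schubert w : A).
Proof. by case: (schubert_basis x) => c [/eqP cx _]; exists c. Qed.

Definition schubert_coord (n : nat) (A : qH_flag n) (x : A) :
  {ffun 'S_n -> Zq n} := xchoose (coord_subproof x).

Lemma schubert_coordP (n : nat) (A : qH_flag n) (x : A) :
  x = \sum_(w : 'S_n) schubert_coord x w *: schubert w.
Proof. exact/eqP/(xchooseP (coord_subproof x)). Qed.

Lemma schubert_coord_unique (n : nat) (A : qH_flag n) (c : {ffun 'S_n -> Zq n}) :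
  schubert_coord (\sum_(w : 'S_n) c w *: (schubert w : A)) = c.
Proof.
set x := \sum_(w : 'S_n) _; case: (schubert_basis x) => d [_ ud].
by rewrite -(ud _ (schubert_coordP x)); apply: ud.
Qed.

(* C_{u,v}^{q^alpha w}: the q^alpha-term of the coefficient of S_w in S_u * S_v
   (the monomial is included). *)
Definition qLR (n : nat) (A : qH_flag n) (u v : 'S_n)
    (alpha : 'X_{1..n.-1}) (w : 'S_n) : Zq n :=
  (schubert_coord ((schubert u : A) * schubert v) w)@_alpha *: 'X_[alpha].

End QuantumCohomology.

(* (alpha, u) stands for the element q^alpha u of S_n[q]. *)
Definition Snq (n : nat) : Type := ('X_{1..n.-1} * 'S_n)%type.

Definition qlen (n : nat) (x : Snq n) : nat := 2 * mdeg x.1 + plen x.2.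

Definition qcover (n k : nat) (x y : Snq n) : Prop :=
  exists i j : 'I_n, [/\ i < k, k <= j, y.2 = fmul x.2 (tperm i j) &
    (y.1 = x.1 /\ (plen x.2).+1 = plen y.2)
    \/ (y.1 = (x.1 + qexp i j)%MM /\ (plen x.2).+1 = plen y.2 + 2 * (j - i))].

Definition qBruhat (n k : nat) : Snq n -> Snq n -> Prop :=
  clos_refl_trans (Snq n) (@qcover n k).

Definition supp (n : nat) (z : 'S_n) : {set 'I_n} := [set i | z i != i].

Definition ncycles (n : nat) (z : 'S_n) : nat :=
  #|[set C in porbits z | 1 < #|C|]|.

(* Minimality of the interval [u, q^alpha w]; it includes u <= q^alpha w. *)
Definition minimal_interval (n k : nat) (u : 'S_n) (alpha : 'X_{1..n.-1})
    (w : 'S_n) : Prop :=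
  qBruhat k (0%MM, u) (alpha, w) /\
  qlen (alpha, w) - plen u =
    #|supp (fmul w u^-1%g)| - ncycles (fmul w u^-1%g).

(* Parts may be zero, and missing parts are read as zero. *)
Definition is_partition (l : seq nat) : bool := sorted geq l.

(* (b, 1^(a-1)); b = 0 forces a = 1, which is the empty partition of 0. *)
Definition is_hook (l : seq nat) : Prop :=
  is_partition l /\ exists a b : nat, 0 < a /\ l = b :: nseq a.-1 1.

(* l fits in the k x (n-k) rectangle, so that v(l,k) is defined. *)
Definition fits (n k : nat) (l : seq nat) : bool :=
  [&& is_partition l, size l <= k & nth 0 l 0 <= n - k].

(* The defining property of v(l,k); with 0-based i and parts, the condition
   v(i) = i + l_{k+1-i} reads v i = i + l_(k-1-i). *)
Definition is_grassmannian (n k : nat) (l : seq nat) (v : 'S_n) : bool :=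
  [forall i : 'I_n, (i < k) ==> (v i == i + nth 0 l (k.-1 - i) :> nat)] &&
  [forall i : 'I_n, forall j : 'I_n, (k <= i < j) ==> (v i < v j)].

Definition vperm (n k : nat) (l : seq nat) : 'S_n :=
  odflt 1%g [pick v : 'S_n | is_grassmannian k l v].

Section Grassmannian.

Variables (n k : nat) (l : seq nat).
Hypotheses (k_le_n : k <= n) (l_fits : fits n k l).

Let hd i := i + nth 0 l (k.-1 - i).
Let hs := [seq hd i | i <- iota 0 k].
Let rest := [seq x <- iota 0 n | x \notin hs].
Let s := hs ++ rest.

Local Lemma part_nth i j : i <= j -> nth 0 l j <= nth 0 l i.
Proof.
move=> ij; case/and3P: l_fits => ls _ _.
case: (ltnP j (size l)) => jl; last by rewrite (nth_default _ jl).
have tr : transitive geq by move=> a b c /= ba cb; apply: leq_trans cb ba.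
have rf : reflexive geq by move=> a; apply: leqnn.
apply: (sorted_leq_nth tr rf 0 ls) => //; rewrite inE //.
exact: leq_ltn_trans ij jl.
Qed.

Local Lemma hd_lt i : i < k -> hd i < n.
Proof.
move=> ik; case/and3P: l_fits => _ _ l0.
have := leq_trans (part_nth (leq0n (k.-1 - i))) l0.
rewrite /hd => le; apply: (@leq_trans (k + (n - k))); last by rewrite subnKC.
by rewrite -addSn leq_add.
Qed.

Local Lemma hd_inj i j : i < j -> hd i < hd j.
Proof.
move=> ij; rewrite /hd -addSn leq_add // part_nth // leq_sub2l //.
exact: ltnW.
Qed.

Local Lemma s_uniq : uniq s.
Proof.
rewrite cat_uniq filter_uniq ?iota_uniq // andbT; apply/andP; split.
  rewrite map_inj_in_uniq ?iota_uniq // => i j _ _ e.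
  by case: (ltngtP i j) => // /hd_inj; rewrite e ltnn.
by apply/hasPn => x; rewrite mem_filter => /andP[].
Qed.

Local Lemma s_perm : perm_eq s (iota 0 n).
Proof.
apply: uniq_perm; rewrite ?s_uniq ?iota_uniq // => x.
rewrite mem_cat mem_filter; case: (boolP (x \in hs)) => //= /mapP[i].
rewrite !mem_iota /= !add0n => ik ->.
by rewrite hd_lt.
Qed.

Local Lemma s_size : size s = n.
Proof. by rewrite (perm_size s_perm) size_iota. Qed.

Local Lemma s_lt (i : 'I_n) : nth 0 s i < n.
Proof.
have : nth 0 s i \in s by rewrite mem_nth // s_size.
by rewrite (perm_mem s_perm) mem_iota.
Qed.

Local Lemma s_inj : injective (fun i : 'I_n => Ordinal (s_lt i)).
Proof.
move=> i j [] /eqP; rewrite nth_uniq ?s_size ?s_uniq // => /eqP e.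
exact: val_inj.
Qed.

Lemma grassmannian_exists : exists v : 'S_n, is_grassmannian k l v.
Proof.
have szh : size hs = k by rewrite size_map size_iota.
exists (perm s_inj); apply/andP; split.
  apply/forallP => i; apply/implyP => ik; rewrite permE /= nth_cat szh ik.
  by rewrite (nth_map 0) ?size_iota // nth_iota.
apply/forallP => i; apply/forallP => j; apply/implyP => /andP[ki ij].
have kj := leq_trans ki (ltnW ij).
rewrite !permE /= !nth_cat szh !ltnNge ki kj /= -ltnNge.
apply: (sorted_ltn_nth ltn_trans); last exact: ltn_sub2r (leq_ltn_trans ki ij) ij.
- exact/sorted_filter/iota_ltn_sorted/ltn_trans.
- rewrite inE -(ltn_add2l (size hs)) -size_cat s_size szh subnKC //.
- rewrite inE -(ltn_add2l (size hs)) -size_cat s_size szh subnKC //.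
Qed.

Lemma vpermP : is_grassmannian k l (vperm n k l).
Proof.
rewrite /vperm; case: pickP => [v //|no].
by case: grassmannian_exists => v; rewrite no.
Qed.

Lemma grassmannian_unique (v v' : 'S_n) :
  is_grassmannian k l v -> is_grassmannian k l v' -> v = v'.
Proof.
move=> /andP[/forallP hv /forallP iv] /andP[/forallP hv' /forallP iv'].
have low (i : 'I_n) : i < k -> v i = v' i.
  move=> ik; apply: val_inj.
  by move: (hv i) (hv' i); rewrite ik /= => /eqP-> /eqP->.
pose p := [seq i : 'I_n <- enum 'I_n | k <= i].
have sp : sorted (fun i j : 'I_n => i < j) p.
  apply: sorted_filter; first by move=> a b c; apply: ltn_trans.
  by have := iota_ltn_sorted 0 n; rewrite -val_enum_ord sorted_map.
have pk i : (i \in p) = (k <= i) by rewrite mem_filter mem_enum andbT.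
have tr : transitive (fun i j : 'I_n => i < j).
  by move=> a b c; apply: ltn_trans.
have key (x : 'S_n) :
    (forall i : 'I_n, [forall j : 'I_n, (k <= i < j) ==> (x i < x j)]) ->
    sorted (fun i j : 'I_n => i < j) (map x p).
  move=> ix; rewrite sorted_map; apply: (sub_in_sorted (P := mem p)) sp.
    move=> i j /[!pk] ki kj ij /=; have /forallP/(_ j) := ix i.
    by rewrite ki ij.
  by apply/allP.
have : map v p = map v' p.
  apply: (irr_sorted_eq tr) (key _ iv) (key _ iv') _.
    by move=> a; apply: ltnn.
  have sub (x y : 'S_n) : (forall i : 'I_n, i < k -> x i = y i) ->
      {subset map x p <= map y p}.
    move=> lo z /mapP[i ip ->]; apply/mapP.
    exists ((y^-1)%g (x i)); last by rewrite permKV.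
    rewrite pk leqNgt; apply/negP => lt; move: (lo _ lt); rewrite permKV.
    by move/perm_inj => e; move: lt; rewrite e ltnNge -pk ip.
  by move=> z; apply/idP/idP; apply: sub => // i /low.
move=> e; apply/permP => i; case: (ltnP i k) => [/low //|]; rewrite -pk => ip.
exact: (eq_in_map v v' p).2 e i ip.
Qed.

End Grassmannian.

(* Main.v *)
From Stdlib Require Import Relation_Operators.
Require Import Defs.
From mathcomp Require Import all_boot all_order all_algebra all_fingroup.
From mathcomp Require Import mpoly.
From mathcomp Require Import zify ring.

Set Implicit Arguments.
Unset Strict Implicit.
Unset Printing Implicit Defensive.

Import GRing.Theory.

(** Let x_i be the class of the divisor (i,i+1) minus that of (i-1,i).  Monk's
formula says that S_u x_i is a signed sum of classes q^beta S_(u(a,b)), one for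
each cover (a,b) of the quantum Bruhat order with i in {a,b}, the sign being +
if i = a and - if i = b, where a < b.  So the coefficient of q^alpha S_w in the
product of S_u with a word in the x_i is a signed count of saturated chains from
u to q^alpha w.

Modulo negligible classes.  A chain with r letters writes u^-1 w as a product of
r transpositions, so r is at least #supp - s, computed for w u^-1; minimality of
the interval says that its rank r attains this bound.  A combination of words
with fewer than r letters therefore contributes nothing at q^alpha w, even after
multiplication by powers of q ([negligible]).  Every Schubert class of length l
is a combination of words with at most l letters ([schubert_ind]), so all the
quantum corrections in the products that define hook classes of size r are
negligible ([negligible_quantum_part]), and identities of classical Schur
functions survive.  In particular, let G be the sum of the monomials of degree r
in x_1, ..., x_k in which exactly m variables occur; then G is a combination of
hook classes of size r ([msum_hooks]).  It remains to find m such that S_u G has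
a nonzero coefficient at q^alpha w.

A chain exists.  The interval contains a chain all of whose transpositions
exchange a position <= k with a position > k.  If two consecutive
transpositions of a valid chain share one end, and one of them contains a
position i strictly between the ends of the other, they can be replaced by two
that both contain i ([star_moves]); disjoint ones commute.  Taking for
i the largest left end, then recursively the largest left end that remains, one
transforms the chain into a product of disjoint stars ([star_normal],
[blocks]): in each star all the transpositions contain a common centre <= k.
Reading off the centres gives a monomial with m variables, where m is the number
of stars.  By minimality no star has a trivial product, so m is at most the
number s of cycles.

No cancellation.  A word with m centres and r letters touches at most m + r
positions, while w differs from u in exactly r + s >= m + r positions; hence in
every word that contributes, the non-central ends are distinct and each of them
is moved exactly once.  The integer w(p) + n (alpha_p - alpha_(p-1)) goes up at
the left end of each transposition of a chain and down at its right end
([lift_step]), and its total change depends only on the two ends of the chain.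
Comparison with the k-Bruhat chain shows that a non-central end lies to the left
of its centre if and only if it is <= k.  So all contributing words have the same
sign ([sign_coherent]), and the coefficient is not zero.

Positions and values are counted from 0 in the code. *)

(** * Covers of the quantum Bruhat order *)

(** Going up from x, and passing from the largest value to the smallest, one
meets z strictly before y.  This cyclic condition describes the classical and
the quantum covers at once. *)
Definition cyc (x y z : nat) : bool :=
  if x < y then x < z < y else (x < z) || (z < y).

Section Length.
Variable n : nat.
Implicit Types (u v w : 'S_n) (i j p : 'I_n) (e : 'I_n * 'I_n).

Definition swap_pos u e : 'S_n := fmul u (tperm e.1 e.2).

Lemma swap_posE u e p : swap_pos u e p = u (tperm e.1 e.2 p).
Proof. exact: fmulE. Qed.

Definition inv_at u (p q : 'I_n) : nat := (p < q) && (u q < u p).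

Lemma plenE u : plen u = \sum_p \sum_q inv_at u p q.
Proof.
rewrite /plen -sum1_card pair_bigA big_mkcond /=.
by apply: eq_bigr => -[p q] _; rewrite inE /inv_at /=; case: ifP.
Qed.

Lemma sum_split2 i j (F : 'I_n -> nat) : i != j ->
  \sum_p F p = F i + F j + \sum_(p | (p != i) && (p != j)) F p.
Proof.
by move=> ij; rewrite (bigD1 i) //= (bigD1 j) 1?eq_sym //= addnA.
Qed.

(** Besides the pair (i,j), exchanging the values at i < j only affects the
pairs that involve a position p between them, and such a p changes the number of
inversions, by 2, exactly when its value also lies between. *)
Lemma plen_swap u i j : i < j -> u i < u j ->
  plen (swap_pos u (i, j)) =
  plen u + 1 + 2 * #|[set p : 'I_n | (i < p < j) && (u i < u p < u j)]|.
Proof.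
move=> ij uij; have nij : i != j by rewrite neq_ltn ij.
have -> : #|[set p : 'I_n | (i < p < j) && (u i < u p < u j)]| =
    \sum_(p | (p != i) && (p != j)) ((i < p < j) && (u i < u p < u j) : nat).
  rewrite -sum1_card [in LHS]big_mkcond [in RHS]big_mkcond /=.
  apply: eq_bigr => p _; rewrite inE.
  by case: eqP => [->|_]; case: eqP => [->|_] //=; case: ifP => //; lia.
have swi : swap_pos u (i, j) i = u j by rewrite swap_posE tpermL.
have swj : swap_pos u (i, j) j = u i by rewrite swap_posE tpermR.
have swo p : p != i -> p != j -> swap_pos u (i, j) p = u p.
  by move=> pi pj; rewrite swap_posE tpermD // eq_sym.
rewrite !plenE !(sum_split2 _ nij).
have decomp v : \sum_(p | (p != i) && (p != j)) \sum_q inv_at v p q =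
    \sum_(p | (p != i) && (p != j)) (inv_at v p i + inv_at v p j) +
    \sum_(p | (p != i) && (p != j)) \sum_(q | (q != i) && (q != j)) inv_at v p q.
  by rewrite -big_split /=; apply: eq_bigr => p _; rewrite (sum_split2 _ nij).
rewrite !decomp.
have -> : \sum_(p | (p != i) && (p != j))
      \sum_(q | (q != i) && (q != j)) inv_at (swap_pos u (i, j)) p q =
    \sum_(p | (p != i) && (p != j)) \sum_(q | (q != i) && (q != j)) inv_at u p q.
  apply: eq_bigr => p /andP[pi pj]; apply: eq_bigr => q /andP[qi qj].
  by rewrite /inv_at !swo.
(* the four terms that involve p and one of i, j *)
have key : \sum_(p | (p != i) && (p != j))
     (inv_at (swap_pos u (i, j)) p i + inv_at (swap_pos u (i, j)) p j +
      inv_at (swap_pos u (i, j)) i p + inv_at (swap_pos u (i, j)) j p) =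
   \sum_(p | (p != i) && (p != j))
     (inv_at u p i + inv_at u p j + inv_at u i p + inv_at u j p +
      2 * ((i < p < j) && (u i < u p < u j) : nat)).
  apply: eq_bigr => p /andP[pi pj].
  rewrite /inv_at swi swj swo //.
  have upi : u p != u i by rewrite (inj_eq perm_inj).
  have upj : u p != u j by rewrite (inj_eq perm_inj).
  move: pi pj upi upj; rewrite -!val_eqE /=; lia.
have ii : inv_at (swap_pos u (i, j)) i i = 0 by rewrite /inv_at !ltnn.
have jj : inv_at (swap_pos u (i, j)) j j = 0 by rewrite /inv_at !ltnn.
have jI : inv_at (swap_pos u (i, j)) j i = 0 by rewrite /inv_at ltnNge ltnW.
have iJ : inv_at (swap_pos u (i, j)) i j = 1 by rewrite /inv_at ij swi swj uij.
have ii' : inv_at u i i = 0 by rewrite /inv_at !ltnn.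
have jj' : inv_at u j j = 0 by rewrite /inv_at !ltnn.
have jI' : inv_at u j i = 0 by rewrite /inv_at ltnNge ltnW.
have iJ' : inv_at u i j = 0 by rewrite /inv_at (ltnNge (u j)) (ltnW uij) andbF.
move: key; rewrite !big_split /= big1_eq ii jj jI iJ ii' jj' jI' iJ'; lia.
Qed.

Lemma swap_posK u e : swap_pos (swap_pos u e) e = u.
Proof. by apply/permP => p; rewrite !swap_posE tpermK. Qed.

(** The condition for u(a,b) to cover u in the quantum Bruhat order.  If u(a) <
u(b), no value between them occurs at a position between a and b and the cover
is classical; if u(b) < u(a), all the values at these positions lie between u(b)
and u(a), and the length drops by the largest possible amount, 2(b-a)-1. *)
Definition admissible u e : bool :=
  (e.1 < e.2) &&
  [forall p : 'I_n, (e.1 < p < e.2) ==> ~~ cyc (u e.1) (u e.2) (u p)].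

Lemma admissibleP u i j : reflect
  (i < j /\ forall p : 'I_n, i < p < j -> ~~ cyc (u i) (u j) (u p))
  (admissible u (i, j)).
Proof.
apply: (iffP andP) => /= -[ij H]; split=> //.
  by move=> p pij; have /forallP/(_ p)/implyP := H; apply.
by apply/forallP => p; apply/implyP; apply: H.
Qed.

Lemma card_between i j : i < j -> #|[set p : 'I_n | i < p < j]| = j - i - 1.
Proof.
move=> ij; have -> : j - i - 1 = \sum_(i.+1 <= p < j) 1%N by rewrite sum_nat_const_nat; lia.
rewrite -sum1_card big_mkcond /= (eq_bigr (fun p : 'I_n => if i < p < j then 1 else 0)); last first.
  by move=> p _; rewrite inE.
rewrite -(big_mkord xpredT (fun p : nat => if i < p < j then 1 else 0)) -big_mkcond /=.
have jn := ltn_ord j.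
rewrite (big_cat_nat (n := i.+1)) //=.
rewrite big1_seq ?add0n; last first.
  by move=> p; rewrite mem_index_iota; lia.
rewrite (big_cat_nat (n := j)) //=; last by lia.
rewrite [X in _ + X]big1_seq ?addn0; last first.
  by move=> p; rewrite mem_index_iota; lia.
by rewrite [in RHS]big_nat_cond [in LHS]big_nat_cond; apply: eq_bigl => p; lia.
Qed.

Lemma cover_classical u i j : i < j ->
  ((plen u).+1 == plen (swap_pos u (i, j))) = admissible u (i, j) && (u i < u j).
Proof.
move=> ij; have [uij|uij] := ltnP (u i) (u j); rewrite ?andbT ?andbF.
  rewrite plen_swap // addn1 -{1}[(plen u).+1]addn0 eqn_add2l eq_sym muln_eq0 /= cards_eq0.
  apply/eqP/admissibleP => [E|[_ H]].
    split=> // p pij; apply/negP; rewrite /cyc uij => up.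
    by have := in_set0 p; rewrite -E inE pij up.
  apply/setP => p; rewrite !inE; apply/negbTE/negP => /andP[pij up].
  by have := H p pij; rewrite /cyc uij up.
have uji : u j < u i.
  rewrite ltn_neqAle uij andbT; apply/eqP => /val_inj/perm_inj e; by move: ij; rewrite e ltnn.
have := @plen_swap (swap_pos u (i, j)) i j ij.
rewrite !swap_posE /= tpermL tpermR swap_posK => /(_ uji) ->; lia.
Qed.

Lemma cover_quantum u i j : i < j ->
  ((plen u).+1 == plen (swap_pos u (i, j)) + 2 * (j - i)) =
  admissible u (i, j) && (u j < u i).
Proof.
move=> ij; have [uji|uij] := ltnP (u j) (u i); rewrite ?andbT ?andbF; last first.
  have uij' : u i < u j.
    rewrite ltn_neqAle uij andbT; apply/eqP => /val_inj/perm_inj e; by move: ij; rewrite e ltnn.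
  by rewrite plen_swap //; lia.
have := @plen_swap (swap_pos u (i, j)) i j ij.
rewrite !swap_posE /= tpermL tpermR swap_posK => /(_ uji) ->.
set B := [set p | _]; have sB : B \subset [set p : 'I_n | i < p < j].
  by apply/subsetP => p; rewrite !inE => /andP[].
have cB := card_between ij.
have -> : ((plen (swap_pos u (i, j)) + 1 + 2 * #|B|).+1 == plen (swap_pos u (i, j)) + 2 * (j - i)) =
   (#|[set p : 'I_n | i < p < j]| <= #|B|).
  by have := subset_leq_card sB; rewrite cB; lia.
have o p : i < p < j -> swap_pos u (i, j) p = u p.
  by move=> pij; rewrite swap_posE tpermD //; apply/eqP => /= e; move: pij; rewrite e ltnn ?andbF.
apply/idP/admissibleP => [le|[_ H]].
  split=> // p pij; have /eqP E : B == [set p : 'I_n | i < p < j] by rewrite eqEcard sB le.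
  have : p \in B by rewrite E inE.
  by rewrite inE /= pij o //= /cyc; case: ifP; lia.
apply: subset_leq_card; apply/subsetP => p; rewrite !inE => pij; rewrite pij o //=.
have upi : u p != u i :> nat.
  by apply/eqP => /val_inj/perm_inj e; move: pij; rewrite e ltnn.
have upj : u p != u j :> nat.
  by apply/eqP => /val_inj/perm_inj e; move: pij; rewrite e ltnn andbF.
by have := H p pij; rewrite /cyc; case: ifP; lia.
Qed.

End Length.

(** * Monk's formula and the classes x_i *)

(** The power of q carried by a cover; it appears when the value at the left end
passes from the largest value to the smallest. *)
Definition wrapq n (u : 'S_n) (e : 'I_n * 'I_n) : 'X_{1..n.-1} :=
  if u e.2 < u e.1 then qexp e.1 e.2 else 0%MM.

Definition qstep n (x : Snq n) (e : 'I_n * 'I_n) : Snq n :=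
  ((x.1 + wrapq x.2 e)%MM, swap_pos x.2 e).

Section Monk.
Variables (n : nat) (A : qH_flag n).
Implicit Types (u v w : 'S_n) (x : Snq n) (e : 'I_n * 'I_n).
Local Open Scope ring_scope.

Notation S := (@schubert n A).

Definition qS x : A := 'X_[x.1] *: S x.2.

(** The sum has one term if 0 < m < n and none otherwise, so the divisor classes
with index 0 and n are 0, which is the convention that makes [chern] uniform. *)
Definition divisor (m : nat) : A :=
  \sum_(p : 'I_n * 'I_n | (p.1.+1 == m) && (p.2 == m :> nat)) S (tperm p.1 p.2).

Notation D := divisor.

Lemma divisor_adj (k0 k1 : 'I_n) : k1 = k0.+1 :> nat -> D k1 = S (tperm k0 k1).
Proof.
move=> e; rewrite /divisor (bigD1 (k0, k1)) /= ?e ?eqxx // big1 ?addr0 // => -[a b] /=.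
rewrite -e => /andP[/andP[/eqP ae /eqP be]] /eqP[]; congr pair; apply: val_inj => //=.
by move: ae; rewrite e => -[].
Qed.

Lemma divisor_out (m : nat) : ~~ (0 < m < n)%N -> D m = 0.
Proof.
move=> h; rewrite /divisor big_pred0 // => -[a b] /=; apply/negbTE.
apply/negP => /andP[/eqP ae /eqP be]; move: h; rewrite -{1}ae -be ltn_ord //.
Qed.

Lemma monk_admissible u (m : nat) :
  S u * D m =
  \sum_(e : 'I_n * 'I_n | (e.1 < m <= e.2)%N && admissible u e) 'X_[wrapq u e] *: S (swap_pos u e).
Proof.
have [mn|h] := boolP (0 < m < n)%N; last first.
  rewrite divisor_out // mulr0 big_pred0 // => -[a b] /=; apply/negbTE.
  by apply: contra h => /andP[/andP[am mb] _]; rewrite (leq_ltn_trans _ am) // (leq_ltn_trans mb).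
case/andP: mn => m0 mn.
have m1 : (m.-1 < n)%N by rewrite (leq_ltn_trans (leq_pred m)).
pose k0 := Ordinal m1; pose k1 := Ordinal mn.
have k01 : k1 = k0.+1 :> nat by rewrite /= prednK.
rewrite (divisor_adj k01 : D m = _) (@schubert_monk n A u k0 k1 k01).
rewrite [RHS](bigID (fun e : 'I_n * 'I_n => u e.1 < u e.2)%N) /=; congr (_ + _).
  apply: eq_big => [[i j]|[i j]] /=.
    have [ij|] := boolP (i < m <= j)%N; last first.
      by rewrite negb_and => /orP[/negbTE->|/negbTE->]; rewrite ?andbF.
    case/andP: ij => im mj.
    by rewrite im mj /= -(cover_classical u (leq_trans im mj)).
  case/and3P => im mj; rewrite (cover_classical u (leq_trans im mj)).
  move=> /andP[_ uij]; rewrite /wrapq /= ltnNge (ltnW uij) /= mpolyX0 scale1r //.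
apply: eq_big => [[i j]|[i j]] /=.
  have [ij|] := boolP (i < m <= j)%N; last first.
    by rewrite negb_and => /orP[/negbTE->|/negbTE->]; rewrite ?andbF.
  case/andP: ij => im mj; have ij := leq_trans im mj.
  rewrite im mj /= (cover_quantum u ij); congr (_ && _).
  have : u i != u j :> nat by apply/eqP => /val_inj/perm_inj e; rewrite e ltnn in ij.
  lia.
case/and3P => im mj; rewrite (cover_quantum u (leq_trans im mj)).
by move=> /andP[_ uij]; rewrite /wrapq /= uij.
Qed.

Lemma qS_qstep x e : 'X_[x.1] *: ('X_[wrapq x.2 e] *: S (swap_pos x.2 e)) = qS (qstep x e).
Proof. by rewrite scalerA -mpolyXD. Qed.

Lemma qS_divisor x (m : nat) :
  qS x * D m = \sum_(e : 'I_n * 'I_n | (e.1 < m <= e.2)%N && admissible x.2 e) qS (qstep x e).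
Proof.
rewrite /qS -scalerAl monk_admissible scaler_sumr; apply: eq_bigr => e _.
exact: qS_qstep.
Qed.

(** The class x_(i+1), a quantum Chern root. *)
Definition chern (i : nat) : A := D i.+1 - D i.

(** The covers counted by D i.+1 and D i agree except for those with an end at
i: a left end at i is counted only by the first, a right end at i only by the
second. *)
Lemma qS_chern x (i : 'I_n) :
  qS x * chern i = \sum_(e : 'I_n * 'I_n | admissible x.2 e && (e.1 == i)) qS (qstep x e)
             - \sum_(e : 'I_n * 'I_n | admissible x.2 e && (e.2 == i)) qS (qstep x e).
Proof.
rewrite /chern mulrBr !qS_divisor.
rewrite (bigID (fun e : 'I_n * 'I_n => e.1 == i)) /= [X in _ - X](bigID (fun e : 'I_n * 'I_n => e.2 == i)) /=.
rewrite opprD addrACA [X in _ + X](_ : _ = 0) ?addr0; last first.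
  apply/eqP; rewrite subr_eq0; apply/eqP; apply: eq_bigl => -[a b] /=.
  by rewrite -!val_eqE /=; case: (admissible _ _) => /=; lia.
congr (_ - _); apply: eq_bigl => -[a b]; rewrite /admissible -!val_eqE /=; lia.
Qed.

Lemma sum_chern k : \sum_(i < k) chern i = D k.
Proof.
rewrite /chern -(big_mkord xpredT (fun i => D i.+1 - D i)) telescope_sumr //.
by rewrite (@divisor_out 0) // subr0.
Qed.

Lemma scoord_lin (a : Zq n) (x y : A) w :
  schubert_coord (a *: x + y) w = a * schubert_coord x w + schubert_coord y w.
Proof.
have -> : a *: x + y = \sum_w [ffun w => a * schubert_coord x w + schubert_coord y w] w *: S w.
  rewrite [in LHS](schubert_coordP x) [in LHS](schubert_coordP y).
  rewrite scaler_sumr -big_split /=; apply: eq_bigr => v _.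
  by rewrite ffunE scalerDl scalerA.
by rewrite schubert_coord_unique ffunE.
Qed.

Lemma scoord0 w : schubert_coord (0 : A) w = 0.
Proof.
by have := scoord_lin (-1) 0 0 w; rewrite scaler0 addr0 mulN1r addNr.
Qed.

Lemma scoordD (x y : A) w :
  schubert_coord (x + y) w = schubert_coord x w + schubert_coord y w.
Proof. by have := scoord_lin 1 x y w; rewrite scale1r mul1r. Qed.

Lemma scoordZ a (x : A) w : schubert_coord (a *: x) w = a * schubert_coord x w.
Proof. by rewrite -[a *: x]addr0 scoord_lin scoord0 addr0. Qed.

Lemma scoord_sum (I : Type) (r : seq I) (P : pred I) (F : I -> A) w :
  schubert_coord (\sum_(i <- r | P i) F i) w =
  \sum_(i <- r | P i) schubert_coord (F i) w.
Proof.
by elim/big_rec2: _ => [|i y x _ <-]; rewrite ?scoord0 ?scoordD.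
Qed.

Lemma scoord_S u w : schubert_coord (S u : A) w = (u == w)%:R.
Proof.
have -> : S u = \sum_v [ffun v => (u == v)%:R] v *: S v.
  rewrite (bigD1 u) //= ffunE eqxx scale1r big1 ?addr0 // => v vu.
  by rewrite ffunE eq_sym (negbTE vu) scale0r.
by rewrite schubert_coord_unique ffunE.
Qed.

Lemma scoord_inj (x : A) : (forall w, schubert_coord x w = 0) -> x = 0.
Proof.
move=> h; rewrite (schubert_coordP x) big1 // => w _; by rewrite h scale0r.
Qed.

End Monk.

(** * Schubert classes as polynomials in the x_i *)

Section Lex.
Variable n : nat.
Implicit Types (u v w : 'S_n) (i j p r s : 'I_n).

(** A number whose base-n digits are the values of v, so that it orders
permutations lexicographically; it makes the recursion on transitions terminate.
*)
Definition lexcode v : nat := \sum_(p : 'I_n) v p * n ^ (n - p).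

Lemma lexcode_max v : lexcode v <= \sum_(p : 'I_n) n * n ^ (n - p).
Proof. by apply: leq_sum => p _; rewrite leq_mul2r (ltnW (ltn_ord _)) orbT. Qed.

Lemma lexcode_lt v i r s : i < r -> r < s -> v i < v s -> v s < v r ->
  lexcode v < lexcode (swap_pos (swap_pos v (r, s)) (i, r)).
Proof.
move=> ir rs vis vsr; set v'' := swap_pos _ _.
have ri : r != i by rewrite neq_ltn ir orbT.
have si : s != i by rewrite neq_ltn (ltn_trans ir rs) orbT.
have sr : s != r by rewrite neq_ltn rs orbT.
have split F : \sum_p F p = F i + (F r + (F s +
    \sum_(p : 'I_n | [&& p != i, p != r & p != s]) F p)) :> nat.
  rewrite (bigD1 i) //= (bigD1 r) //= (bigD1 s) ?sr ?si //=.
  by do 3!congr (_ + _); apply: eq_bigl => p; rewrite andbA.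
rewrite /lexcode !split.
have -> : v'' i = v s by rewrite !swap_posE /= tpermL tpermL.
have -> : v'' r = v i by rewrite !swap_posE /= tpermR tpermD.
have -> : v'' s = v r by rewrite !swap_posE /= (@tpermD _ i r s) 1?eq_sym // tpermR.
rewrite [X in _ < _ + (_ + (_ + X))](eq_bigr (fun p => v p * n ^ (n - p))); last first.
  by move=> p /and3P[pi pr ps]; rewrite !swap_posE /= !tpermD // eq_sym.
set B := n ^ (n - r); set C := n ^ (n - s).
have n0 : 0 < n by apply: leq_ltn_trans (ltn_ord i).
have B0 : 0 < B by rewrite expn_gt0 n0.
have : n * B <= n ^ (n - i).
  rewrite -expnS leq_pexp2l //; have := ltn_ord r; lia.
have := ltn_ord (v r); move: (n ^ (n - i)) => a vrn aB.
have h1 : (v r - v i) * B <= n.-1 * B by rewrite leq_mul2r; lia.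
have h2 : (v s - v i) * a >= a by rewrite leq_pmull // subn_gt0.
have h3 : v s * C <= v r * C by rewrite leq_mul2r (ltnW vsr) orbT.
have -> : v s * a = v i * a + (v s - v i) * a by rewrite -mulnDl subnKC // ltnW.
have -> : v r * B = v i * B + (v r - v i) * B.
  by rewrite -mulnDl subnKC // ltnW // (ltn_trans vis).
have : n.-1 * B < n * B by rewrite ltn_mul2r B0; lia.
move: h1 h2 h3 aB; clear -B C a.
move: (\sum_(p | _) _) (v i * a) (v i * B) (v s * C) (v r * C) ((v r - v i) * B) ((v s - v i) * a).
move: (n.-1 * B) (n * B); lia.
Qed.

(** The data of the transition formula: r is the last position that starts an
inversion, and s is the last position whose value is smaller than v r. *)
Lemma last_descent v : v != 1%g -> exists r s : 'I_n,
  [/\ r < s, v s < v r, forall p q : 'I_n, r < p -> p < q -> v p < v q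
    & forall q : 'I_n, s < q -> v r < v q].
Proof.
move=> v1.
have tot (p q : 'I_n) : p < q -> (v p < v q) || (v q < v p).
  by move=> pq; rewrite -neq_ltn val_eqE (inj_eq perm_inj) neq_ltn pq.
pose Pr := [pred r : 'I_n | [exists s : 'I_n, (r < s) && (v s < v r)]].
have [r0 r0P|no] := pickP Pr; last first.
  case/eqP: v1; apply/permP => p; rewrite perm1.
  have inc (p1 q1 : 'I_n) : p1 < q1 -> v p1 < v q1.
    move=> pq; case/orP: (tot _ _ pq) => // h.
    by have := no p1; rewrite inE => /existsP[]; exists q1; rewrite pq h.
  apply: val_inj => /=.
  have lo m (hm : m < n) : m <= v (Ordinal hm).
    elim: m hm => // m IH hm; have hm' := ltnW hm.
    by apply: leq_ltn_trans (IH hm') _; apply: inc.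
  have hi m (hm : n - m.+1 < n) : v (Ordinal hm) <= n - m.+1.
    elim: m hm => [|m IH] hm; first by have := ltn_ord (v (Ordinal hm)); lia.
    have [mn|nm] := ltnP m.+1 n; last first.
      have hm' : n - m.+1 < n by lia.
      have e : Ordinal hm = Ordinal hm' by apply: val_inj => /=; lia.
      by have := IH hm'; rewrite e; lia.
    have hm' : n - m.+1 < n by lia.
    have lt : Ordinal hm < Ordinal hm' by move=> /=; lia.
    by have := inc _ _ lt; have := IH hm'; lia.
  have hp := ltn_ord p.
  have hm : n - (n - p.+1).+1 < n by lia.
  have := hi (n - p.+1) hm; have := lo p hp.
  have -> : Ordinal hm = p by apply: val_inj => /=; lia.
  have -> : Ordinal hp = p by apply: val_inj.
  lia.
case: (arg_maxnP (fun r : 'I_n => r) r0P) => r /existsP[s0 s0P] rmax.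
case: (@arg_maxnP _ s0 (fun s : 'I_n => (r < s) && (v s < v r)) (fun s : 'I_n => s) s0P).
move=> s /andP[rs vsr] smax; exists r, s; split=> //.
  move=> p q rp pq; case/orP: (tot _ _ pq) => // h.
  have : p <= r by apply: rmax; apply/existsP; exists q; rewrite pq h.
  by rewrite leqNgt rp.
move=> q sq; have rq := ltn_trans rs sq; case/orP: (tot _ _ rq) => // h.
have : q <= s by apply: smax; rewrite rq h.
by rewrite leqNgt sq.
Qed.

Lemma plen1 : plen (1%g : 'S_n) = 0.
Proof.
apply/eqP; rewrite cards_eq0; apply/eqP/setP => -[p q]; rewrite !inE !perm1 /=.
lia.
Qed.

Lemma admissible_lt u i j : admissible u (i, j) -> i < j.
Proof. by case/andP. Qed.

Lemma plen_classical u i j : admissible u (i, j) -> u i < u j ->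
  plen (swap_pos u (i, j)) = (plen u).+1.
Proof.
move=> h uij; have ij := admissible_lt h.
by apply/esym/eqP; rewrite cover_classical // h uij.
Qed.

Lemma plen_quantum u i j : admissible u (i, j) -> u j < u i ->
  plen (swap_pos u (i, j)) + 2 * (j - i) = (plen u).+1.
Proof.
move=> h uij; have ij := admissible_lt h.
by apply/esym/eqP; rewrite cover_quantum // h uij.
Qed.

Lemma admissible_desc u i j : admissible u (i, j) -> ~~ (u i < u j) -> u j < u i.
Proof.
move=> /admissible_lt ij; rewrite -leqNgt leq_eqVlt => /orP[/eqP/val_inj/perm_inj e|//].
by rewrite e ltnn in ij.
Qed.

End Lex.

Section Induction.
Variables (n : nat) (A : qH_flag n).
Implicit Types (u v w : 'S_n) (x y : A) (e : 'I_n * 'I_n).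
Local Open Scope ring_scope.

Notation S := (@schubert n A).
Notation X := (@chern n A).

Lemma qS0 v : S v = qS A (0%MM, v).
Proof. by rewrite /qS /= mpolyX0 scale1r. Qed.

(** The transition formula.  With r, s as in [last_descent] and v' = v (r,s),
Monk's formula for S_v' x_r has S_v as its only classical term with left end r;
the terms with right end r have the length of v but are lexicographically
larger, and the quantum terms are shorter.  So a class of length l is a
combination over Z[q] of classes obtained from S_1 by at most l multiplications
by some x_i. *)
Lemma schubert_ind (P : nat -> A -> Prop) :
  (forall l x, P l x -> P l.+1 x) ->
  (forall l a x y, P l x -> P l y -> P l (a *: x + y)) ->
  (forall l x (i : 'I_n), P l x -> P l.+1 (x * X i)) ->
  P 0 (S 1%g) -> forall v, P (plen v) (S v).
Proof.
move=> Pm Pl PX P1.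
have P0 l : P l 0.
  elim: l => [|l /Pm //]; by rewrite -(addNr (S 1%g)) -scaleN1r; apply: Pl.
have Pmono l l' x : (l <= l')%N -> P l x -> P l' x.
  elim: l' => [|l' IH]; first by rewrite leqn0 => /eqP->.
  by rewrite leq_eqVlt => /orP[/eqP-> //|/IH h /h /Pm].
have Psum l (I : Type) (r : seq I) (Q : pred I) (F : I -> A) :
    (forall i, Q i -> P l (F i)) -> P l (\sum_(i <- r | Q i) F i).
  move=> h; elim/big_rec: _ => [//|i y Qi Py].
  by rewrite -[F i]scale1r; apply: Pl => //; apply: h.
have PZ l a x : P l x -> P l (a *: x) by move=> h; rewrite -[_ *: _]addr0; apply: Pl.
move=> v; have [l] := ubnP (plen v); elim: l v => // l IHl v.
rewrite ltnS => lvl.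
have [m] := ubnP (\sum_(p : 'I_n) n * n ^ (n - p) - lexcode v)%N.
elim: m v lvl => // m IHm v lvl; rewrite ltnS => mv.
have [->|v1] := eqVneq v 1%g; first by rewrite plen1.
have [r [s [rs vsr inc smax]]] := last_descent v1.
set v' := swap_pos v (r, s).
have v'r : v' r = v s by rewrite swap_posE tpermL.
have v's : v' s = v r by rewrite swap_posE tpermR.
have v'o p : p != r -> p != s -> v' p = v p.
  by move=> pr ps; rewrite swap_posE tpermD // eq_sym.
have v'v : swap_pos v' (r, s) = v by rewrite swap_posK.
have adm0 : admissible v' (r, s).
  apply/admissibleP; split=> // p /andP[rp ps].
  rewrite v'r v's v'o ?neq_ltn ?rp ?ps ?orbT //.
  by rewrite /cyc vsr; have := inc _ _ rp ps; lia.
have lv' : plen v = (plen v').+1 by rewrite -v'v plen_classical ?v'r ?v's.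
have lowq (i j : 'I_n) : admissible v' (i, j) -> (v' j < v' i)%N ->
    P (plen v) (qS A (qstep (0%MM, v') (i, j))).
  move=> h lt; apply: PZ => /=; have := plen_quantum h lt; have ij := admissible_lt h => lq.
  have lt' : (plen (swap_pos v' (i, j)) < plen v)%N by lia.
  by apply: Pmono (ltnW lt') _; apply: IHl; lia.
have := qS_chern A (0%MM, v') r; rewrite -qS0 /=.
rewrite (bigD1 (r, s)) /= ?adm0 ?eqxx //.
rewrite {1}/qS /qstep /= v'v /wrapq /= v'r v's ltnNge (ltnW vsr) /= addm0 mpolyX0 scale1r.
rewrite -addrA => /esym/(canRL (addrK _)) ->; rewrite opprD opprK.
rewrite -[_ * _]scale1r; apply: (Pl _ _ _ _).
  by rewrite lv'; apply: (PX _ _ _); apply: (IHl _); lia.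
rewrite -scaleN1r; apply: (Pl _ _ _ _).
  apply: (Psum _) => -[i j] /= /andP[/andP[h /eqP e]]; rewrite {}e {i} in h *.
  rewrite xpair_eqE eqxx /= => js; apply: lowq => //; apply: contraT => nlt.
  have rj := admissible_lt h; have jr : j != r by rewrite neq_ltn rj orbT.
  have lt : (v' r < v' j)%N by apply: contraR nlt => /(admissible_desc h).
  have [sj|] := ltnP s j; last rewrite leq_eqVlt val_eqE (negbTE js) /= => jls.
    case/admissibleP: h => _ /(_ s); rewrite rs sj => /(_ isT).
    by rewrite /cyc lt v's v'r vsr v'o // smax.
  by move: lt; rewrite v'r v'o // ltnNge (ltnW (inc _ _ rj jls)).
apply: (Psum _) => -[i j] /= /andP[h /eqP e]; rewrite {}e {j} in h *.
have ir := admissible_lt h; have [lt|/(admissible_desc h)] := boolP (v' i < v' r)%N; last exact: lowq.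
have nir : i != r by rewrite neq_ltn ir.
have nis : i != s by rewrite neq_ltn (ltn_trans ir rs).
have vis : (v i < v s)%N by move: lt; rewrite v'r v'o.
have pl : plen (swap_pos v' (i, r)) = plen v by rewrite plen_classical.
apply: (PZ _) => /=; rewrite -pl; apply: IHm; first by rewrite pl.
have := lexcode_lt ir rs vis vsr; have := lexcode_max (swap_pos v' (i, r)).
by rewrite -/v'; lia.
Qed.

End Induction.

(** * Products of hook classes with the x_i *)

Lemma perm_of_fun n (f : nat -> nat) :
  (forall p, p < n -> f p < n) ->
  (forall p q, p < n -> q < n -> f p = f q -> p = q) ->
  exists v : 'S_n, forall p : 'I_n, v p = f p :> nat.
Proof.
move=> fn finj; have inj : injective (fun p : 'I_n => Ordinal (fn p (ltn_ord p))).
  by move=> p q [] /finj e; apply: val_inj; apply: e.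
by exists (perm inj) => p; rewrite permE.
Qed.

(** One-line notation of v(lambda,k) for the hook lambda = (b,1^(a-1)). *)
Definition hookf (b a k p : nat) : nat :=
  if p < k - a then p else if p.+1 < k then p.+1 else
  if p.+1 == k then k + b - 1 else if p == k then k - a else
  if p < k + b then p - 1 else p.

(** One-line notation of the permutation that appears between two hook
permutations in Monk's formula: the positions k and k+1 (from 0) of
v((b,1^(a-2)),k) are exchanged. *)
Definition midf (b a k p : nat) : nat :=
  if p < k.+1 - a then p else if p.+1 < k then p.+1 else
  if p.+1 == k then k + b - 1 else if p == k then k else
  if p == k.+1 then k.+1 - a else
  if p < k + b then p - 1 else p.

Definition hook b a : seq nat := b :: nseq a.-1 1.

(** The hook (b,1^(a-1)) fits in the k x (n-k) rectangle. *)
Definition hook_fits n b a k := [&& 0 < a, a <= k, 0 < b & k + b <= n].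

Ltac split_if := repeat (case: ifP => ?); try lia.

Lemma fits_hook n k b a : hook_fits n b a k -> fits n k (hook b a).
Proof.
case/and4P => a0 ak b0 kb.
apply/and3P; split; [|by rewrite /= size_nseq prednK|by rewrite /=; lia].
rewrite /is_partition /hook /=; case: (a.-1) => //= c; rewrite b0 /=.
by elim: c => //= c IH; rewrite IH.
Qed.

Lemma hook_vperm n k b a : hook_fits n b a k ->
  forall p : 'I_n, vperm n k (hook b a) p = hookf b a k p :> nat.
Proof.
move=> g; case/and4P: (g) => a0 ak b0 kb.
have hn p : p < n -> hookf b a k p < n by move=> pn; rewrite /hookf; split_if.
have hi p q : p < n -> q < n -> hookf b a k p = hookf b a k q -> p = q.
  by move=> pn qn; rewrite /hookf; split_if.
have [v vf] := perm_of_fun hn hi.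
have fit := fits_hook g.
have gv : is_grassmannian k (hook b a) v.
  apply/andP; split.
    apply/forallP => p; apply/implyP => pk; rewrite vf /hook /hookf; apply/eqP.
    case E : (k.-1 - p) => [|m] /=; first by split_if.
    by rewrite nth_nseq; split_if.
  apply/forallP => p; apply/forallP => q; apply/implyP => pq.
  by rewrite !vf /hookf; split_if.
have kn : k <= n by lia.
by move=> p; rewrite (grassmannian_unique (vpermP kn fit) gv) vf.
Qed.

Section Hooks.
Variables (n : nat) (A : qH_flag n).
Implicit Types (u v w : 'S_n) (k i j : 'I_n) (e : 'I_n * 'I_n).
Local Open Scope ring_scope.

Notation S := (@schubert n A).
Notation X := (@chern n A).

(** A Schubert class given by one-line notation; the sum is empty if f is not a
permutation of the first n integers. *)
Definition Sf (f : nat -> nat) : A :=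
  \sum_(v : 'S_n | [forall p : 'I_n, v p == f p :> nat]) S v.

Lemma Sf_eq (f : nat -> nat) v : (forall p : 'I_n, v p = f p :> nat) -> Sf f = S v.
Proof.
move=> h; rewrite /Sf (bigD1 v) /=; last by apply/forallP => p; rewrite h.
rewrite big1 ?addr0 // => w /andP[/forallP hw]; case/eqP; apply/permP => p.
by apply: val_inj; rewrite /= h (eqP (hw p)).
Qed.

(** Hooks that do not fit count as 0, so that the recursion on hooks needs no
boundary cases. *)
Definition hookS (b a k : nat) : A :=
  if hook_fits n b a k then S (vperm n k (hook b a)) else 0.

Notation H := hookS.

Lemma hookS_eq (b a k : nat) v : hook_fits n b a k ->
  (forall p : 'I_n, v p = hookf b a k p :> nat) -> H b a k = S v.
Proof.
move=> g h; rewrite /hookS g; congr S; apply/permP => p; apply: val_inj.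
by rewrite /= hook_vperm // h.
Qed.

(** The terms without q of S_v x_k come from covers with left end k, with sign
+, and from covers with right end k, with sign -; both are isolated here from
the terms with a positive power of q. *)
Definition up_covers v k : A :=
  \sum_(e : 'I_n * 'I_n | admissible v e && (e.1 == k) && (v e.1 < v e.2)%N) S (swap_pos v e).
Definition low_covers v k : A :=
  \sum_(e : 'I_n * 'I_n | admissible v e && (e.2 == k) && (v e.1 < v e.2)%N) S (swap_pos v e).
Definition quantum_part v k : A :=
  \sum_(e : 'I_n * 'I_n | admissible v e && (e.1 == k) && ~~ (v e.1 < v e.2)%N) qS A (qstep (0%MM, v) e) -
  \sum_(e : 'I_n * 'I_n | admissible v e && (e.2 == k) && ~~ (v e.1 < v e.2)%N) qS A (qstep (0%MM, v) e).

Lemma S_chern v k : S v * X k = up_covers v k - low_covers v k + quantum_part v k.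
Proof.
rewrite qS0 qS_chern /= (bigID (fun e : 'I_n * 'I_n => v e.1 < v e.2)%N) /=.
rewrite [X in _ - X](bigID (fun e : 'I_n * 'I_n => v e.1 < v e.2)%N) /=.
rewrite opprD addrACA; congr (_ - _ + _); apply: eq_bigr => e /andP[_ lt].
all: by rewrite /qstep /= /wrapq ltnNge (ltnW lt) /= addm0 -qS0.
Qed.

Lemma up_covers_one v k j0 : admissible v (k, j0) -> (v k < v j0)%N ->
  (forall j, admissible v (k, j) -> (v k < v j)%N -> j = j0) -> up_covers v k = S (swap_pos v (k, j0)).
Proof.
move=> h lt un; rewrite /up_covers (bigD1 (k, j0)) /= ?h ?lt ?eqxx // big1 ?addr0 //.
move=> -[a j] /= /andP[/andP[/andP[hj /eqP ak] ltj]]; rewrite {}ak in hj ltj *.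
by rewrite (un j) // eqxx.
Qed.

Lemma up_covers_none v k :
  (forall j, admissible v (k, j) -> ~~ (v k < v j)%N) -> up_covers v k = 0.
Proof.
move=> un; rewrite /up_covers big_pred0 // => -[a j] /=; apply/negbTE/negP.
by move=> /andP[/andP[hj /eqP ak] ltj]; rewrite {}ak in hj ltj; rewrite (negbTE (un _ hj)) in ltj.
Qed.

Lemma low_covers_one v k i0 : admissible v (i0, k) -> (v i0 < v k)%N ->
  (forall i, admissible v (i, k) -> (v i < v k)%N -> i = i0) -> low_covers v k = S (swap_pos v (i0, k)).
Proof.
move=> h lt un; rewrite /low_covers (bigD1 (i0, k)) /= ?h ?lt ?eqxx // big1 ?addr0 //.
move=> -[i a] /= /andP[/andP[/andP[hj /eqP ak] ltj]]; rewrite {}ak in hj ltj *.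
by rewrite (un i) // eqxx.
Qed.

Lemma low_covers_none v k :
  (forall i, admissible v (i, k) -> ~~ (v i < v k)%N) -> low_covers v k = 0.
Proof.
move=> un; rewrite /low_covers big_pred0 // => -[i a] /=; apply/negbTE/negP.
by move=> /andP[/andP[hj /eqP ak] ltj]; rewrite {}ak in hj ltj; rewrite (negbTE (un _ hj)) in ltj.
Qed.

Lemma admissible_no v (i j p : 'I_n) : admissible v (i, j) -> (v i < v j)%N -> (i < p < j)%N -> ~~ (v i < v p < v j)%N.
Proof. by case/admissibleP => _ h lt /h; rewrite /cyc lt. Qed.

Lemma swap_pos_val v (i j p : 'I_n) :
  nat_of_ord (swap_pos v (i, j) p) = (if p == i then v j : nat else if p == j then v i : nat else v p).
Proof.
rewrite swap_posE /=; case: tpermP => [->|->|/eqP/negbTE-> /eqP/negbTE->] //.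
  by rewrite eqxx.
by rewrite eqxx; case: eqP => // ->.
Qed.

Lemma hookS_out (b a k : nat) : ~~ hook_fits n b a k -> H b a k = 0.
Proof. by rewrite /hookS => /negbTE->. Qed.

Section Row.
Variables (b a : nat) (k : 'I_n) (v : 'S_n).
Hypothesis g : hook_fits n b a k.+1.
Hypothesis hv : forall p : 'I_n, v p = hookf b a k.+1 p :> nat.

Let vk : v k = (k + b)%N :> nat.
Proof. by case/and4P: g => *; rewrite hv /hookf; split_if. Qed.

Lemma up_covers_row : up_covers v k = H b.+1 a k.+1.
Proof.
case/and4P: (g) => a0 ak b0 kb.
have big (j : 'I_n) : (v k < v j)%N -> (k + b < j)%N /\ v j = j :> nat.
  by rewrite vk hv /hookf; split_if.
(* if n = k+1+b the row is already full: no cover on the left, no hook on the right *)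
have [lt|kb'] := ltnP (k + b.+1)%N n; last first.
  rewrite hookS_out; last by apply/negP => /and4P[*]; lia.
  by apply: up_covers_none => j h; apply/negP => /big[]; have := ltn_ord j; lia.
pose j0 : 'I_n := Ordinal lt.
have vj0 : v j0 = (k + b.+1)%N :> nat by rewrite hv /hookf /=; split_if.
have h0 : admissible v (k, j0).
  apply/admissibleP; split=> [|p pk /=]; first by rewrite /=; lia.
  have := big p; rewrite /= in pk; rewrite /cyc vk vj0; split_if.
rewrite (up_covers_one h0) ?vk ?vj0; last 2 first.
- by lia.
- move=> j h; rewrite -vk => lt'; have [kj vj] := big _ lt'; apply: val_inj => /=.
  have := @admissible_no v k j j0 h lt'; rewrite vk vj0 vj /=; lia.
symmetry; apply: hookS_eq; first by apply/and4P; split=> //; lia.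
move=> p; rewrite swap_pos_val vk vj0 -!val_eqE /= hv /hookf; split_if.
Qed.

Lemma low_covers_row1 : a = 1%N -> low_covers v k = H b.+1 1 k.
Proof.
case/and4P: (g) => a0 ak b0 kb a1.
have small (i : 'I_n) : (i < k)%N -> v i = i :> nat by rewrite hv /hookf; split_if.
have [k0|k0] := posnP k.
  rewrite hookS_out; last by apply/negP => /and4P[*]; lia.
  by apply: low_covers_none => i /admissible_lt; rewrite k0.
have lt : (k.-1 < n)%N by have := ltn_ord k; lia.
pose i0 : 'I_n := Ordinal lt.
have vi0 : v i0 = k.-1 :> nat by rewrite small //=; lia.
have h0 : admissible v (i0, k).
  by apply/admissibleP; split=> [|p /= pk]; rewrite /=; lia.
rewrite (low_covers_one h0) ?vk ?vi0; last 2 first.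
- by lia.
- move=> i h lt'; have ik := admissible_lt h; apply: val_inj => /=.
  have := @admissible_no v i k i0 h; rewrite vk vi0 small //=; lia.
symmetry; apply: hookS_eq; first by apply/and4P; split=> //; lia.
move=> p; rewrite swap_pos_val vk vi0 -!val_eqE /= hv /hookf a1; split_if.
Qed.

Lemma low_covers_row2 : (1 < a)%N -> low_covers v k = Sf (midf b.+1 a k).
Proof.
case/and4P: (g) => a0 ak b0 kb a1.
have small (i : 'I_n) : (i < k)%N -> (i <= v i <= k)%N by rewrite hv /hookf; split_if.
have lt : (k.-1 < n)%N by have := ltn_ord k; lia.
pose i0 : 'I_n := Ordinal lt.
have vi0 : v i0 = k :> nat by rewrite hv /hookf /=; split_if.
have h0 : admissible v (i0, k).
  by apply/admissibleP; split=> [|p /= pk]; rewrite /=; lia.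
rewrite (low_covers_one h0) ?vk ?vi0; last 2 first.
- by lia.
- move=> i h lt'; have ik := admissible_lt h; apply: val_inj => /=.
  have := @admissible_no v i k i0 h; rewrite vk vi0; have := small _ ik.
  have : i != i0 -> v i != v i0 by rewrite (inj_eq perm_inj).
  rewrite -!val_eqE /= vi0; lia.
symmetry; apply: Sf_eq.
move=> p; rewrite swap_pos_val vk vi0 -!val_eqE /= hv /hookf /midf; split_if.
Qed.

End Row.

Section Column.
Variables (b a : nat) (k : 'I_n) (v : 'S_n).
Hypothesis g : hook_fits n b a k.
Hypothesis hv : forall p : 'I_n, v p = hookf b a k p :> nat.

Let vk : v k = (k - a)%N :> nat.
Proof. by case/and4P: g => *; rewrite hv /hookf; split_if. Qed.

Let incr (i j : 'I_n) : (k < i)%N -> (i < j)%N -> (v k < v i < v j)%N.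
Proof. by case/and4P: g => *; rewrite vk !hv /hookf; split_if. Qed.

Lemma up_covers_col1 : b = 1%N -> up_covers v k = H 1 a.+1 k.+1.
Proof.
case/and4P: (g) => a0 ak b0 kb b1.
have [lt|kb'] := ltnP k.+1 n; last first.
  rewrite hookS_out; last by apply/negP => /and4P[*]; lia.
  by apply: up_covers_none => j /admissible_lt; have := ltn_ord j; lia.
pose j0 : 'I_n := Ordinal lt.
have vj0 : v j0 = k.+1 :> nat by rewrite hv /hookf /=; split_if.
have h0 : admissible v (k, j0).
  by apply/admissibleP; split=> [|p /= pk]; rewrite /=; lia.
rewrite (up_covers_one h0) ?vk ?vj0; last 2 first.
- by lia.
- move=> j h lt'; have ik := admissible_lt h; apply: val_inj => /=.
  have := @admissible_no v k j j0 h; rewrite vk vj0 /=.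
  have := @incr j0 j; rewrite vk vj0 /=; lia.
symmetry; apply: hookS_eq; first by apply/and4P; split=> //; lia.
move=> p; rewrite swap_pos_val vk vj0 -!val_eqE /= hv /hookf b1; split_if.
Qed.

Lemma up_covers_col2 : (1 < b)%N -> up_covers v k = Sf (midf b a.+1 k).
Proof.
case/and4P: (g) => a0 ak b0 kb b1.
have lt : (k.+1 < n)%N by lia.
pose j0 : 'I_n := Ordinal lt.
have vj0 : v j0 = k :> nat by rewrite hv /hookf /=; split_if.
have h0 : admissible v (k, j0).
  by apply/admissibleP; split=> [|p /= pk]; rewrite /=; lia.
rewrite (up_covers_one h0) ?vk ?vj0; last 2 first.
- by lia.
- move=> j h lt'; have ik := admissible_lt h; apply: val_inj => /=.
  have := @admissible_no v k j j0 h; rewrite vk vj0 /=.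
  have := @incr j0 j; rewrite vk vj0 /=; lia.
symmetry; apply: Sf_eq.
move=> p; rewrite swap_pos_val vk vj0 -!val_eqE /= hv /hookf /midf; split_if.
Qed.

Lemma low_covers_col : low_covers v k = H b a.+1 k.
Proof.
case/and4P: (g) => a0 ak b0 kb.
have small (i : 'I_n) : (i < k)%N -> (v i < v k)%N -> v i = i :> nat by rewrite vk hv /hookf; split_if.
have [k0|k0] := leqP k a.
  rewrite hookS_out; last by apply/negP => /and4P[*]; lia.
  by apply: low_covers_none => i /admissible_lt; rewrite vk; lia.
have lt : (k - a.+1 < n)%N by have := ltn_ord k; lia.
pose i0 : 'I_n := Ordinal lt.
have vi0 : v i0 = (k - a.+1)%N :> nat by rewrite hv /hookf /=; split_if.
have h0 : admissible v (i0, k).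
  apply/admissibleP; split=> [|p /= pk]; first by rewrite /=; lia.
  by rewrite /cyc vi0 vk; split_if.
rewrite (low_covers_one h0) ?vk ?vi0; last 2 first.
- by lia.
- move=> i h; rewrite -vk => lt'; have ik := admissible_lt h; apply: val_inj => /=.
  have := @admissible_no v i k i0 h lt'; move: (lt'); rewrite vk vi0 small //=; lia.
symmetry; apply: hookS_eq; first by apply/and4P; split=> //; lia.
move=> p; rewrite swap_pos_val vk vi0 -!val_eqE /= hv /hookf; split_if.
Qed.

End Column.

End Hooks.

(** * The class of the identity permutation *)

Section Unit.
Variables (n : nat) (A : qH_flag n).
Hypothesis n1 : (1 < n)%N.
Implicit Types (u v w : 'S_n) (e : 'I_n * 'I_n).
Local Open Scope ring_scope.

Notation S := (@schubert n A).
Notation X := (@chern n A).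
Notation D := (@divisor n A).
Notation H := (@hookS n A).

Lemma scale_eq0 (a : Zq n) (x : A) : a != 0 -> a *: x = 0 -> x = 0.
Proof.
move=> a0 ax; apply: scoord_inj => w; have := scoordZ a x w.
by rewrite ax scoord0 => /esym/eqP; rewrite mulf_eq0 (negbTE a0) => /eqP.
Qed.

Lemma S1_divisor m : S 1%g * D m = D m.
Proof.
rewrite monk_admissible [in RHS]/divisor; apply: eq_big => [[i j]|[i j]] /=.
  have [ij|] := boolP (i.+1 == m :> nat) => /=.
    rewrite -(eqP ij) ltnSn /=; apply/andP/eqP => [[ij' /admissibleP[lt h]]|ji].
      apply/eqP; rewrite eqn_leq ij' andbT leqNgt; apply/negP => lt'.
      have lti : (i.+1 < n)%N by have := ltn_ord j; lia.
      by have := h (Ordinal lti); rewrite !perm1 /cyc /= ltnSn lt' lt => /(_ isT).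
    split; first by rewrite ji.
    by apply/admissibleP; split=> [|p]; rewrite ji // => /andP[]; lia.
  move=> im; apply/negbTE/negP => /andP[/andP[im' mj] /admissibleP[lt h]].
  have lti : (i.+1 < n)%N by have := ltn_ord j; lia.
  have := h (Ordinal lti); rewrite !perm1 /cyc /= lt ltnSn.
  have -> : (i.+1 < j)%N by lia.
  by move=> /(_ isT).
move=> /andP[/andP[im mj] /admissibleP[ij _]].
rewrite /wrapq /= !perm1 ltnNge (ltnW ij) /= mpolyX0 scale1r; congr S.
by apply/permP => p; rewrite swap_posE perm1.
Qed.

Let y : A := 1 - S 1%g.

Let yD m : y * D m = 0.
Proof. by rewrite mulrBl mul1r S1_divisor subrr. Qed.

Let yX i : y * X i = 0.
Proof. by rewrite /chern mulrBr !yD subrr. Qed.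

Lemma tperm_hook (k k1 : 'I_n) : k1 = k.+1 :> nat ->
  forall p : 'I_n, tperm k k1 p = hookf 1 1 k.+1 p :> nat.
Proof.
move=> kk p; have := ltn_ord k1; case: tpermP => [->|->|/eqP + /eqP].
- by rewrite /hookf; split_if.
- by rewrite /hookf; split_if.
- by rewrite -!val_eqE /= /hookf; split_if.
Qed.

(** The row recursion for hooks with its quantum term: S_(k,k+1) x_k is the
difference of the classes of (2) for k and for k-1, plus q_k.  As y kills x_k,
the classes y S_(2) telescope. *)
Let yH k : (k < n)%N -> exists2 a : Zq n,
  y * H 2 1 k = - (a *: (y * S 1%g)) & a.@[fun=> 1] = k%:R.
Proof.
elim: k => [|k IH] kn.
  by exists 0; rewrite ?meval0 // hookS_out // scale0r oppr0 mulr0.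
have [a yk a1] := IH (ltnW kn).
pose k0 := Ordinal (ltnW kn : k < n)%N; pose k1 := Ordinal kn.
have k01 : k1 = k0.+1 :> nat by [].
have hk := tperm_hook k01.
have fit : hook_fits n 1 1 k0.+1 by apply/and4P; split=> //=; lia.
have := S_chern A (tperm k0 k1) k0.
rewrite (up_covers_row A fit hk) (low_covers_row1 A fit hk erefl) => E.
have Q : quantum_part A (tperm k0 k1) k0 = 'X_[qexp k0 k1] *: S 1%g.
  rewrite /quantum_part (bigD1 (k0, k1)) /=; last first.
    rewrite eqxx tpermL tpermR /= andbT -leqNgt leqnSn andbT.
    by apply/admissibleP; split=> //= p; lia.
  rewrite big1; last first.
    move=> -[i j] /= /andP[/andP[/andP[h /eqP ik] lt] ne]; move: lt; rewrite ik !hk /=.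
    have ij := admissible_lt h; rewrite ik /= in ij.
    have : (j != k1 :> nat) by apply: contra ne; rewrite ik => /eqP e; apply/eqP; congr pair; apply: val_inj.
    by rewrite /hookf /=; split_if.
  rewrite big_pred0; last first.
    move=> -[i j] /=; apply/negbTE/negP => /andP[/andP[h /eqP jk]]; rewrite jk in h *.
    by have ij := admissible_lt h; rewrite !hk /hookf /=; rewrite /= in ij; split_if.
  rewrite addr0 subr0 /qS /qstep /wrapq /= tpermL tpermR ltnSn add0m.
  by congr (_ *: S _); apply/permP => p; rewrite swap_posE perm1 tpermK.
have : y * (S (tperm k0 k1) * X k0) = 0 by rewrite mulrCA yX mulr0.
rewrite E Q !mulrDr mulrN -scalerAr yk opprK => E0.
exists ('X_[qexp k0 k1] + a); last first.
  rewrite mevalD a1 mevalX big1 => [|i _]; last by rewrite expr1n.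
  by rewrite -[k.+1%:R]natr1 addrC.
by apply/eqP; rewrite -addr_eq0 scalerDl [X in _ + X]addrC addrA E0.
Qed.

(** The class y = 1 - S_1 kills the divisors.  Since no hook (2) fits for k =
n-1, the recursion [yH] ends in (q_1 + ... + q_(n-1)) y S_1 = 0, so y kills S_1;
by [schubert_ind] it kills every Schubert class, hence 1. *)
Lemma S1 : S 1%g = 1.
Proof.
have yE : y * S 1%g = 0.
  have lt : (n.-1 < n)%N by lia.
  have [a + a1] := yH lt; rewrite hookS_out ?mulr0; last by apply/negP => /and4P[*]; lia.
  move=> /esym/eqP; rewrite oppr_eq0 => /eqP; apply: scale_eq0.
  apply/eqP => a0; move/eqP: a1; rewrite a0 meval0 eq_sym Num.Theory.pnatr_eq0; lia.
have yS v : y * S v = 0.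
  apply: (schubert_ind (P := fun _ x => y * x = 0)) => //.
  - by move=> _ a x z hx hz; rewrite mulrDr -scalerAr hx hz scaler0 addr0.
  - by move=> _ x i hx; rewrite mulrA hx mul0r.
have : y * 1 = 0.
  rewrite (schubert_coordP (1 : A)) mulr_sumr big1 // => w _.
  by rewrite -scalerAr yS scaler0.
by rewrite mulr1 => /eqP; rewrite subr_eq0 => /eqP.
Qed.

End Unit.

(** * Negligible classes *)

Section Negligible.
Variables (n : nat) (A : qH_flag n).
Implicit Types (u v w : 'S_n) (e : 'I_n * 'I_n).

Notation S := (@schubert n A).
Notation X := (@chern n A).

(** The least number of transpositions with product g, as n minus the number of
orbits. *)
Definition abslen (g : 'S_n) : nat := n - #|porbits g|.

Lemma card_porbits (g : 'S_n) : #|porbits g| <= n.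
Proof. by rewrite -[X in _ <= X](card_ord n) leq_imset_card. Qed.

Lemma abslen_tperm (g : 'S_n) i j : abslen (tperm i j * g)%g <= (abslen g).+1.
Proof.
have := porbits_mul_tperm g i j; rewrite /abslen /=.
have := card_porbits (tperm i j * g)%g; have := card_porbits g.
have [<-|ij] := eqVneq i j; first by rewrite porbit_id /=; lia.
by case: (i \notin _) => /=; lia.
Qed.

Definition dist u w : nat := abslen (u^-1 * w)%g.

Lemma dist_swap u w e : dist u w <= (dist (swap_pos u e) w).+1.
Proof.
have -> : dist u w = abslen (tperm (u e.1) (u e.2) * ((swap_pos u e)^-1 * w))%g.
  rewrite /dist /swap_pos /fmul invMg tpermV -tpermJ /conjg !mulgA; congr (abslen (_ * w)%g).
  by rewrite -!mulgA (mulKVg u) tperm2 mulg1.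
exact: abslen_tperm.
Qed.

Lemma dist_refl u : dist u u = 0.
Proof.
rewrite /dist mulVg /abslen; apply/eqP; rewrite subn_eq0 -{1}(card_ord n).
rewrite card_imset // => i j /eqP; rewrite eq_porbit_mem.
by rewrite -[1%g](expg0 1%g) => /porbitP[m ->]; rewrite expg1n perm1.
Qed.

Local Open Scope ring_scope.

(** The classes that do not contribute to the coefficient at w of a product with
S_u when u^-1 w is not a product of fewer than r transpositions. *)
Definition negligible (r : nat) (x : A) : Prop :=
  forall u w, (r <= dist u w)%N -> schubert_coord (S u * x) w = 0.

Lemma negligible_mono r r' x : (r <= r')%N -> negligible r x -> negligible r' x.
Proof. by move=> le h u w /(leq_trans le)/h. Qed.

Lemma negligible_lin r (a : Zq n) x z : negligible r x -> negligible r z -> negligible r (a *: x + z).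
Proof.
move=> hx hz u w le; rewrite mulrDr -scalerAr scoordD scoordZ hx // hz //.
by rewrite mulr0 addr0.
Qed.

Lemma negligible0 r : negligible r 0.
Proof. by move=> u w _; rewrite mulr0 scoord0. Qed.

Lemma negligibleZ r (a : Zq n) x : negligible r x -> negligible r (a *: x).
Proof. by move=> h; rewrite -[_ *: _]addr0; apply: negligible_lin => //; apply: negligible0. Qed.

Lemma negligibleD r x z : negligible r x -> negligible r z -> negligible r (x + z).
Proof. by move=> hx hz; rewrite -[x]scale1r; apply: negligible_lin. Qed.

Lemma negligibleN r x : negligible r x -> negligible r (- x).
Proof. by rewrite -scaleN1r; apply: negligibleZ. Qed.

Lemma negligible_sum r (I : Type) (s : seq I) (P : pred I) (F : I -> A) :
  (forall i, P i -> negligible r (F i)) -> negligible r (\sum_(i <- s | P i) F i).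
Proof.
move=> h; elim/big_rec: _ => [|i x Pi hx]; first exact: negligible0.
by apply: negligibleD => //; apply: h.
Qed.

Lemma negligible_chern r x (i : 'I_n) : negligible r x -> negligible r.+1 (x * X i).
Proof.
move=> hx u w le.
have low e : schubert_coord (qS A (qstep (0%MM, u) e) * x) w = 0.
  rewrite /qS -scalerAl scoordZ hx ?mulr0 //=.
  by have := dist_swap u w e; lia.
rewrite [x * _]mulrC mulrA qS0 qS_chern mulrBl !mulr_suml -scaleN1r scoordD scoordZ.
by rewrite !scoord_sum !big1 // mulr0 addr0.
Qed.

Hypothesis n1 : (1 < n)%N.

(** By [schubert_ind] a class of length l is a combination of words with at most
l letters, and each letter moves by one transposition. *)
Lemma negligible_S v : negligible (plen v).+1 (S v).
Proof.
apply: (schubert_ind (P := fun l x => negligible l.+1 x)).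
- by move=> l x; apply: negligible_mono.
- by move=> l a x z; apply: negligible_lin.
- by move=> l x i; apply: negligible_chern.
rewrite (S1 A n1) => u w; rewrite mulr1 scoord_S; case: eqVneq => // ->.
by rewrite dist_refl.
Qed.

(** A term with a positive power of q is the class of a permutation at least two
shorter than the classical terms. *)
Lemma negligible_quantum_part v (k : 'I_n) : negligible (plen v) (quantum_part A v k).
Proof.
have low i j : admissible v (i, j) -> ~~ (v i < v j)%N -> negligible (plen v) (qS A (qstep (0%MM, v) (i, j))).
  move=> h /(admissible_desc h) lt; apply: negligibleZ.
  apply: (negligible_mono _ (@negligible_S _)) => /=.
  by have := plen_quantum h lt; have := admissible_lt h; lia.
apply: negligibleD; last apply: negligibleN; apply: negligible_sum => -[i j] /= /andP[/andP[h _]]; exact: low.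
Qed.

End Negligible.

(** * Hook classes and sums of monomials *)

Lemma card_le_code (T : finType) (P : {set T}) (c : T -> nat) N :
  {in P &, injective c} -> (forall x, x \in P -> c x < N) -> #|P| <= N.
Proof.
move=> inj lt; rewrite cardE -(size_map c) -[X in _ <= X](size_iota 0).
apply: uniq_leq_size; last first.
  by move=> _ /mapP[x xP ->]; rewrite mem_iota /= lt // -mem_enum.
rewrite map_inj_in_uniq ?enum_uniq // => x y; rewrite !mem_enum; exact: inj.
Qed.

(** The inversions are those of the largest moved value with the b positions
that follow it, and those of the smallest moved value with the a-1 other raised
values. *)
Lemma plen_hook n b a k (v : 'S_n) : hook_fits n b a k ->
  (forall p : 'I_n, v p = hookf b a k p :> nat) -> plen v <= a + b - 1.
Proof.
case/and4P => a0 ak b0 kb hv.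
(* 0..b-1 number the inversions of the row, b..a+b-2 those of the column *)
pose c (p : 'I_n * 'I_n) := if p.1.+1 == k then p.2 - k else b + (p.1 - (k - a)).
have loc p q : p < q -> hookf b a k q < hookf b a k p ->
    (p.+1 == k) && (k <= q < k + b) || (q == k) && (k - a <= p) && (p.+1 < k).
  by rewrite /hookf; split_if.
apply: (card_le_code (c := c)).
  move=> [p q] [p' q']; rewrite !inE /= !hv => /andP[/loc h /h {}h] /andP[/loc h' /h' {}h'].
  rewrite /c /= => e; have [ep eq] : p = p' :> nat /\ q = q' :> nat.
    by move: e h h'; split_if.
  by congr pair; apply: val_inj.
move=> [p q]; rewrite inE /= !hv => /andP[/loc h /h {}h].
by rewrite /c /=; move: h; split_if.
Qed.

(** With g listing the words in the letters < k, the words in the letters <= k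
that begin with the letter k, with r letters of which m are different. *)
Fixpoint words_top (g : nat -> nat -> seq (seq nat)) (k m r : nat) : seq (seq nat) :=
  match r, m with
  | r'.+1, m'.+1 => [seq k :: s | s <- g m' r' ++ words_top g k m r']
  | _, _ => [::]
  end.

(** The weakly decreasing words in the letters < k with r letters, m of them
different; they index the monomials of degree r in k variables in which exactly
m variables occur. *)
Fixpoint words (k m r : nat) : seq (seq nat) :=
  if k is k'.+1 then words k' m r ++ words_top (words k') k' m r
  else if (m == 0) && (r == 0) then [:: [::]] else [::].

(** The coefficient (-1)^(a+1-m) binomial(a,m-1), given by the recursion that
the proof uses, of the hook (r-a,1^a) in the sum of the monomials of degree r
with exactly m variables. *)
Fixpoint hook_coef (a m : nat) : int :=
  if a is a'.+1 then (if m is m'.+1 then hook_coef a' m' else 0%R) - hook_coef a' m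
  else ((m == 1)%:R)%R.

Section HookStep.
Variables (n : nat) (A : qH_flag n).
Hypothesis n1 : (1 < n)%N.
Local Open Scope ring_scope.

Notation S := (@schubert n A).
Notation X := (@chern n A).
Notation D := (@divisor n A).
Notation H := (@hookS n A).
Notation negligible := (@negligible n A).

Lemma hookS_vperm b a k : hook_fits n b a k -> H b a k = S (vperm n k (hook b a)).
Proof. by rewrite /hookS => ->. Qed.

(** For a = 1 the intermediate permutation of the hook recursion is itself a
hook permutation. *)
Definition row_rest b a k : A := if a == 1%N then H b 1 k else Sf A (midf b a k).

(** A transition at the end of the row of the hook. *)
Lemma row_step b a (k : 'I_n) : (0 < b)%N -> (0 < a)%N ->
  negligible (a + b) (H b.+1 a k.+1 - (X k * H b a k.+1 +
     (if hook_fits n b a k.+1 then row_rest b.+1 a k else 0))).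
Proof.
move=> b0 a0; case: ifPn => [fit|nfit].
  rewrite (hookS_vperm fit); set v := vperm _ _ _.
  have hv := hook_vperm fit; rewrite -/v in hv.
  rewrite [X k * _]mulrC S_chern (up_covers_row A fit hv).
  have -> : low_covers A v k = row_rest b.+1 a k.
    rewrite /row_rest; have [a1|a1] := eqVneq a 1%N; first exact: (low_covers_row1 A fit hv).
    by apply: (low_covers_row2 A fit hv); lia.
  have -> (h l q : A) : h - (h - l + q + l) = - q by ring.
  apply: negligibleN; apply: (negligible_mono _ (@negligible_quantum_part _ _ n1 _ _)).
  by have := plen_hook fit hv; lia.
rewrite [H b a k.+1]hookS_out // [H b.+1 a k.+1]hookS_out; last first.
  apply: contra nfit => /and4P[*]; apply/and4P; split=> //; lia.
rewrite mulr0 addr0 subr0; exact: negligible0.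
Qed.

(** A transition at the foot of the column of the hook. *)
Lemma col_step b a (k : 'I_n) : (0 < b)%N -> (0 < a)%N ->
  negligible (a + b) (X k * H b a k - ((if hook_fits n b a k then
     if b == 1%N then H 1 a.+1 k.+1 else Sf A (midf b a.+1 k) else 0) - H b a.+1 k)).
Proof.
move=> b0 a0; case: ifPn => [fit|nfit].
  rewrite (hookS_vperm fit); set v := vperm _ _ _.
  have hv := hook_vperm fit; rewrite -/v in hv.
  rewrite [X k * _]mulrC S_chern (low_covers_col A fit hv).
  have -> : up_covers A v k = if b == 1%N then H 1 a.+1 k.+1 else Sf A (midf b a.+1 k).
    have [b1|b1] := eqVneq b 1%N; first exact: (up_covers_col1 A fit hv).
    by apply: (up_covers_col2 A fit hv); lia.
  rewrite addrC addKr; apply: (negligible_mono _ (@negligible_quantum_part _ _ n1 _ _)).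
  by have := plen_hook fit hv; lia.
rewrite [H b a k]hookS_out // [H b a.+1 k]hookS_out; last first.
  apply: contra nfit => /and4P[*]; apply/and4P; split=> //; lia.
rewrite mulr0 !subr0; exact: negligible0.
Qed.

(** The recursion of hook Schur functions in the last variable: in a tableau of
hook shape with entries at most k+1, either the row ends in k+1 and its last box
is removed; or only the column does, and its last box is removed; or k+1 does
not occur.  The intermediate permutation of [row_step] and [col_step] cancels.
*)
Lemma hook_step b a (k : 'I_n) : (0 < b)%N -> (0 < a)%N -> (2 < a + b)%N ->
  negligible (a + b).-1 (H b a k.+1 -
    (H b a k + X k * H b.-1 a k.+1 + X k * H b a.-1 k)).
Proof.
case: b => // b _; case: a => // a _; rewrite [(_.+1 + _)%N]addSn /= => ab.
have Hb0 c j : H 0 c j = 0 by apply: hookS_out; apply/negP => /and4P[].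
have Ha0 c j : H c 0 j = 0 by apply: hookS_out; apply/negP => /and4P[].
have [b0|b0] := posnP b; last first.
  have R := @row_step b a.+1 k b0 isT.
  have [a0|a0] := posnP a; last first.
    have C := @col_step b.+1 a k isT a0.
    have guard : hook_fits n b a.+1 k.+1 = hook_fits n b.+1 a k.
      by rewrite /hook_fits; lia.
    have -> : H b.+1 a.+1 k.+1 - (H b.+1 a.+1 k + X k * H b a.+1 k.+1 + X k * H b.+1 a k) =
      (H b.+1 a.+1 k.+1 - (X k * H b a.+1 k.+1 +
        (if hook_fits n b a.+1 k.+1 then row_rest b.+1 a.+1 k else 0))) -
      (X k * H b.+1 a k - ((if hook_fits n b.+1 a k then
     if b.+1 == 1%N then H 1 a.+1 k.+1 else Sf A (midf b.+1 a.+1 k) else 0) - H b.+1 a.+1 k)).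
      by rewrite guard /row_rest eqSS (gtn_eqF a0) eqSS (gtn_eqF b0); ring.
    by apply: negligibleD; [rewrite -addSnnS|apply: negligibleN].
  subst a; rewrite Ha0 mulr0 addr0 [H b.+1 1 k + _]addrC.
  move: R; rewrite /row_rest /=.
  have -> : (if hook_fits n b 1 k.+1 then H b.+1 1 k else 0) = H b.+1 1 k.
    case: ifPn => // nf; rewrite hookS_out //; apply: contra nf.
    by rewrite /hook_fits; lia.
  by rewrite add1n add0n.
subst b; have a0 : (0 < a)%N by lia.
have C := @col_step 1 a k isT a0; rewrite Hb0 mulr0 addr0.
have -> : H 1 a.+1 k.+1 - (H 1 a.+1 k + X k * H 1 a k) =
   - (X k * H 1 a k - (H 1 a.+1 k.+1 - H 1 a.+1 k)) by ring.
apply: negligibleN; move: C => /=.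
suff -> : (if hook_fits n 1 a k then H 1 a.+1 k.+1 else 0) = H 1 a.+1 k.+1 by [].
case: ifPn => // nf; rewrite hookS_out //; apply: contra nf.
by rewrite /hook_fits; lia.
Qed.

Definition monomial (s : seq nat) : A := \prod_(i <- s) X i.

Definition msum k m r : A := \sum_(s <- words k m r) monomial s.

Lemma msum0 k m : msum k m 0 = (m == 0)%:R.
Proof.
elim: k => [|k IH]; rewrite /msum /=; last by rewrite cats0; exact: IH.
by rewrite andbT; case: eqP => _; rewrite ?big_nil // big_seq1 /monomial big_nil.
Qed.

Definition msum_pred k m r : A := if m is m'.+1 then msum k m' r else 0.

Lemma msum_step k m r :
  msum k.+1 m r.+1 = msum k m r.+1 + X k * (msum_pred k m r + (msum k.+1 m r - msum k m r)).
Proof.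
have T m' r' : msum k.+1 m' r' = msum k m' r' + \sum_(s <- words_top (words k) k m' r') monomial s.
  by rewrite /msum /= big_cat.
rewrite [LHS]T; congr (_ + _); rewrite [msum k.+1 m r]T [msum k m r + _]addrC addrK.
case: m => [|m] /=; first by case: r => [|r] /=; rewrite !big_nil addr0 mulr0.
rewrite big_map /msum -big_cat mulr_sumr.
by apply: eq_bigr => s _; rewrite /monomial big_cons.
Qed.

Definition hook_sum k m r : A := \sum_(a < r) (hook_coef a m)%:~R *: H (r - a) a.+1 k.

Definition hook_sum_pred k m r : A := if m is m'.+1 then hook_sum k m' r else 0.

(** The recursion for [hook_coef] is chosen so that the combination of hooks
obeys the recursion [msum_step]. *)
Lemma hook_sum_step (k : 'I_n) m r : (0 < r)%N ->
  negligible r.+1 (hook_sum k.+1 m r.+1 -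
    (hook_sum k m r.+1 + X k * (hook_sum_pred k m r + (hook_sum k.+1 m r - hook_sum k m r)))).
Proof.
move=> r0.
have e1 : X k * hook_sum k.+1 m r =
    \sum_(a < r.+1) (hook_coef a m)%:~R *: (X k * H (r.+1 - a).-1 a.+1 k.+1).
  rewrite big_ord_recr /= subSn // subnn /= [H 0 _ _]hookS_out; last by apply/negP => /and4P[].
  rewrite mulr0 scaler0 addr0 /hook_sum mulr_sumr; apply: eq_bigr => a _.
  by rewrite scalerAr subSn // ltnW.
have e2 : X k * (hook_sum_pred k m r - hook_sum k m r) =
    \sum_(a < r.+1) (hook_coef a m)%:~R *: (X k * H (r.+1 - a) a k).
  rewrite big_ord_recl /= [H _ 0 _]hookS_out; last by apply/negP => /and4P[].
  rewrite mulr0 scaler0 add0r.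
  have -> : hook_sum_pred k m r - hook_sum k m r = \sum_(a < r) (hook_coef a.+1 m)%:~R *: H (r - a) a.+1 k.
    rewrite /hook_sum -sumrN; case: m {e1} => [|m] /=.
      by rewrite add0r; apply: eq_bigr => a _; rewrite sub0r rmorphN scaleNr.
    rewrite -big_split /=; apply: eq_bigr => a _.
    by rewrite rmorphB scalerBl.
  rewrite mulr_sumr; apply: eq_bigr => a _; by rewrite scalerAr subSS.
rewrite [hook_sum_pred _ _ _ + _]addrCA mulrDr e1 e2 /hook_sum -!big_split -sumrB /=.
apply: negligible_sum => a _; rewrite -!scalerDr -scalerBr; apply: negligibleZ.
rewrite addrA; have := @hook_step (r.+1 - a) a.+1 k.
have ar := ltn_ord a.
have -> : (a.+1 + (r.+1 - a)).-1 = r.+1 by lia.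
by apply; lia.
Qed.

Lemma hookS11 k : (k < n)%N -> H 1 1 k = D k.
Proof.
case: k => [|k] kn.
  by rewrite divisor_out // hookS_out //; apply/negP => /and4P[].
pose k0 := Ordinal (ltnW kn); pose k1 := Ordinal kn.
have k01 : k1 = k0.+1 :> nat by [].
rewrite (divisor_adj A k01 : D k.+1 = _); apply: hookS_eq; last exact: tperm_hook k01.
by apply/and4P; split=> //=; lia.
Qed.

Lemma msum1 k m : msum k m 1 = (m == 1%N)%:R * D k.
Proof.
rewrite -sum_chern; elim: k => [|k IH].
  by rewrite big_ord0 mulr0 /msum /= andbF big_nil.
rewrite msum_step IH big_ord_recr /= !msum0 subrr addr0 mulrDr; congr (_ + _).
by case: m {IH} => [|m]; rewrite /= ?msum0 ?mulr0 ?mul0r // eqSS mulrC.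
Qed.

(** Both sides satisfy the same recursion in the number of variables and in the
degree, up to negligible classes, and agree in degree 1. *)
Lemma msum_hooks m r k : (0 < r)%N -> (k < n)%N -> negligible r (msum k m r - hook_sum k m r).
Proof.
elim: r m k => // r IH m k _.
have [r0|r0] := posnP r.
  subst r => kn; rewrite msum1 /hook_sum big_ord1 /= subn0 hookS11 //.
  case: eqP => _; rewrite ?scale1r ?scale0r ?mul1r ?mul0r subrr; exact: negligible0.
elim: k => [|k IHk] kn.
  rewrite /msum /= andbF big_nil sub0r; apply: negligibleN; rewrite /hook_sum.
  apply: negligible_sum => a _; rewrite hookS_out ?scaler0; first exact: negligible0.
  by apply/negP => /and4P[].
pose k0 := Ordinal (ltnW kn).
have step := @hook_sum_step k0 m r r0; rewrite /= in step.
rewrite msum_step.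
have -> : msum k m r.+1 + X k * (msum_pred k m r + (msum k.+1 m r - msum k m r)) - hook_sum k.+1 m r.+1 =
  (msum k m r.+1 - hook_sum k m r.+1) +
  ((((msum k.+1 m r - hook_sum k.+1 m r) - (msum k m r - hook_sum k m r)) +
    (msum_pred k m r - hook_sum_pred k m r)) * X k0 -
  (hook_sum k.+1 m r.+1 - (hook_sum k m r.+1 +
    X k * (hook_sum_pred k m r + (hook_sum k.+1 m r - hook_sum k m r))))).
  by rewrite /=; ring.
apply: negligibleD; first exact: IHk (ltnW kn).
apply: negligibleD; last exact: negligibleN.
apply: negligible_chern; apply: negligibleD; last first.
  case: m {IHk step} => [|m] /=; first by rewrite subrr; exact: negligible0.
  exact: IH (ltnW kn).
by apply: negligibleD; [exact: IH|apply: negligibleN; exact: IH (ltnW kn)].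
Qed.

End HookStep.

(** * Moves on words of transpositions *)

Section Words.
Variable n : nat.
Implicit Types (u v w : 'S_n) (x : Snq n) (e f : 'I_n * 'I_n) (s t : seq ('I_n * 'I_n)).

(** A list of pairs of positions is read as a word of transpositions, applied
from left to right; it is valid at x if every step is a cover. *)
Fixpoint valid x s : bool :=
  if s is e :: s' then admissible x.2 e && valid (qstep x e) s' else true.

Definition endpt x s : Snq n := foldl (@qstep n) x s.

Lemma valid_cat x s t : valid x (s ++ t) = valid x s && valid (endpt x s) t.
Proof. by elim: s x => //= e s IH x; rewrite IH andbA. Qed.

Lemma endpt_cat x s t : endpt x (s ++ t) = endpt (endpt x s) t.
Proof. exact: foldl_cat. Qed.

(** Replacing s by t inside a word keeps it valid and does not change its end
point, power of q included. *)
Definition rewrites s t : Prop :=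
  forall x, valid x s -> valid x t /\ endpt x t = endpt x s.

Lemma rewrites_trans s2 s1 s3 : rewrites s1 s2 -> rewrites s2 s3 -> rewrites s1 s3.
Proof. by move=> h h' x /h[/h'[? ->]]. Qed.

Lemma rewrites_cat s s' t t' : rewrites s s' -> rewrites t t' -> rewrites (s ++ t) (s' ++ t').
Proof.
move=> h h' x; rewrite !valid_cat !endpt_cat => /andP[/h[-> ->] /h'[-> ->]] //.
Qed.

Lemma wrapqE u e m : wrapq u e m = (u e.2 < u e.1) && (e.1 <= m < e.2) :> nat.
Proof. by rewrite /wrapq; case: ifP => _; rewrite ?mnmE ?mnm0E. Qed.

Lemma rewrites2 e f g h :
  (forall u, admissible u e -> admissible (swap_pos u e) f ->
    [/\ admissible u g, admissible (swap_pos u g) h, swap_pos (swap_pos u g) h = swap_pos (swap_pos u e) f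
      & forall m, wrapq u g m + wrapq (swap_pos u g) h m = wrapq u e m + wrapq (swap_pos u e) f m]) ->
  rewrites [:: e; f] [:: g; h].
Proof.
move=> H x /= /and3P[/H h1 /h1[-> -> E W] _]; split=> //.
rewrite /endpt /= /qstep /= E -!addmA; congr ((_ + _)%MM, _).
by apply/mnmP => m; rewrite !mnmDE.
Qed.

Lemma cycE a b c : cyc a b c =
  (a < b) && ((a < c) && (c < b)) || (b <= a) && ((a < c) || (c < b)).
Proof. by rewrite /cyc; case: (ltnP a b) => h /=; rewrite ?orbF. Qed.

Definition disj e f := [&& e.1 != f.1, e.1 != f.2, e.2 != f.1 & e.2 != f.2].

Lemma disjC e f : disj e f = disj f e.
Proof.
rewrite /disj !(eq_sym e.1) !(eq_sym e.2) !andbA; congr (_ && _).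
by rewrite -!andbA; congr (_ && _); rewrite andbC.
Qed.

Lemma val_neq u (i j : 'I_n) : i != j -> u i != u j :> nat.
Proof. by move=> ij; apply/eqP => /val_inj/perm_inj e; rewrite e eqxx in ij. Qed.

(** Positions outside both letters carry the same values in both orders.  At the
four ends, validity constrains the cyclic order of four values, and this
constraint is symmetric in e and f. *)
Lemma rewrites_comm e f : disj e f -> rewrites [:: e; f] [:: f; e].
Proof.
case: e f => [a b] [c d] /and4P[/= ac ad bc bd]; apply: rewrites2 => u.
have vac := val_neq u ac; have vad := val_neq u ad.
have vbc := val_neq u bc; have vbd := val_neq u bd.
have [ca da cb db] : [/\ c != a, d != a, c != b & d != b] by rewrite ![c == _]eq_sym ![d == _]eq_sym.
move=> /admissibleP[ab H1] /admissibleP[cd H2].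
have sc : nat_of_ord (swap_pos u (a, b) c) = u c by rewrite swap_pos_val !(negbTE ca) (negbTE cb).
have sd : nat_of_ord (swap_pos u (a, b) d) = u d by rewrite swap_pos_val !(negbTE da) (negbTE db).
have sa : nat_of_ord (swap_pos u (c, d) a) = u a by rewrite swap_pos_val !(negbTE ac) (negbTE ad).
have sb : nat_of_ord (swap_pos u (c, d) b) = u b by rewrite swap_pos_val !(negbTE bc) (negbTE bd).
have sa' : nat_of_ord (swap_pos u (a, b) a) = u b by rewrite swap_pos_val eqxx.
have sb' : nat_of_ord (swap_pos u (a, b) b) = u a by rewrite swap_pos_val eqxx; case: eqP => // ->.
have cond (p : 'I_n) : c < p < d -> ~~ cyc (u c) (u d) (u p).
  have := H2 p; have := H2 a; have := H2 b; have := H1 c; have := H1 d.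
  rewrite sc sd sa' sb' swap_pos_val !cycE -!val_eqE /=.
  move: ca da cb db; rewrite -!val_eqE /=.
  by case: ifP => [/eqP/val_inj ->|_]; [|case: ifP => [/eqP/val_inj ->|_]]; lia.
split.
- by apply/admissibleP.
- apply/admissibleP; split=> // p; rewrite sa sb.
  have := H1 p; have := H1 c; have := H1 d; have := cond a; have := cond b.
  have := H2 a; have := H2 b; rewrite sc sd sa' sb'.
  rewrite swap_pos_val !cycE -!val_eqE /=.
  move: ca da cb db; rewrite -!val_eqE /=.
  by case: ifP => [/eqP/val_inj ->|_]; [|case: ifP => [/eqP/val_inj ->|_]]; lia.
- apply/permP => p; rewrite !swap_posE /=; congr (u _).
  case: (tpermP a b p) => [->|->|pa pb].
  + by rewrite (@tpermD _ c d b) // (@tpermD _ c d a) // tpermL.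
  + by rewrite (@tpermD _ c d b) // (@tpermD _ c d a) // tpermR.
  case: (tpermP c d p) => [_|_|_ _].
  + by rewrite tpermD // eq_sym.
  + by rewrite tpermD // eq_sym.
  by rewrite tpermD //; apply/eqP => h; [apply: pa|apply: pb].
- by move=> m; rewrite !wrapqE /= sa sb sc sd addnC.
Qed.

Lemma swap3_eq (a b i : 'I_n) u : a != b -> i != a -> i != b ->
  [/\ swap_pos (swap_pos u (a, i)) (i, b) = swap_pos (swap_pos u (a, b)) (a, i),
      swap_pos (swap_pos u (i, b)) (a, i) = swap_pos (swap_pos u (a, b)) (i, b),
      swap_pos (swap_pos u (i, b)) (a, i) = swap_pos (swap_pos u (a, i)) (a, b)
    & swap_pos (swap_pos u (a, i)) (i, b) = swap_pos (swap_pos u (i, b)) (a, b)].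
Proof.
move=> ab ia ib; have [ba ai bi] : [/\ b != a, a != i & b != i].
  by rewrite eq_sym ab (eq_sym a) ia (eq_sym b) ib.
have E := (negbTE ab, negbTE ia, negbTE ib, negbTE ba, negbTE ai, negbTE bi, eqxx).
have tE (y z p : 'I_n) : tperm y z p = if p == y then z else if p == z then y else p.
  by rewrite permE.
split; apply/permP => p; rewrite !swap_posE !tE /=; congr (u _).
all: have [e|pa] := eqVneq p a; [subst p|]; rewrite ?E ?(negbTE pa) //=.
all: have [e|pb] := eqVneq p b; [subst p|]; rewrite ?E ?(negbTE pa) ?E //=.
all: have [e|pi] := eqVneq p i; [subst p|]; rewrite ?E ?(negbTE pa) ?(negbTE pb) ?(negbTE pi) ?E //=.
Qed.

(** Among the ways to write a 3-cycle on a < i < b as two successive covers, the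
one in which both transpositions contain the middle position i is implied by
each of the two others.  The proof splits the cyclic interval of values swept by
one step at the value of i. *)
Lemma star_moves (a b i : 'I_n) : a < i -> i < b ->
  [/\ rewrites [:: (a, b); (a, i)] [:: (a, i); (i, b)],
      rewrites [:: (a, b); (i, b)] [:: (i, b); (a, i)],
      rewrites [:: (a, i); (a, b)] [:: (i, b); (a, i)]
    & rewrites [:: (i, b); (a, b)] [:: (a, i); (i, b)]].
Proof.
move=> ai ib; have ab := ltn_trans ai ib.
have [nab nia nib] : [/\ a != b, i != a & i != b] by split; rewrite -val_eqE /=; lia.
have [nba nai nbi] : [/\ b != a, a != i & b != i] by split; rewrite -val_eqE /=; lia.
have E := (negbTE nab, negbTE nia, negbTE nib, negbTE nba, negbTE nai, negbTE nbi, eqxx).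
have out (p : 'I_n) : (a < p < i) || (i < p < b) ->
    [/\ p == a = false, p == b = false & p == i = false] /\
    [/\ a < p, p < b & (p < i) = ~~ (i < p)].
  by move=> h; split; split; rewrite -?val_eqE /=; lia.
split; apply: rewrites2 => u; have [S1 S2 S3 S4] := swap3_eq u nab nia nib;
  have vab := val_neq u nab; have vai := val_neq u nia; have vib := val_neq u nib;
  move=> /admissibleP[_ H1] /admissibleP[_ H2]; split=> //.
all: try (by move=> m; move: (H1 i) (H2 i) vab vai vib; rewrite !wrapqE /= !swap_pos_val !E /= !cycE; lia).
all: apply/admissibleP; split=> // p pin; have [|[pa pb pi] [ap pb' pp]] := out p; first by rewrite pin ?orbT.
all: move: (val_neq u (negbT pa)) (val_neq u (negbT pb)) (val_neq u (negbT pi)).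
all: move: (H1 i) (H2 i) (H1 p) (H2 p) vab vai vib; rewrite !swap_pos_val !E /= ?pa ?pb ?pi.
all: rewrite ?ap ?pb' ?ai ?ib ?ltnn ?pp; move: pin; rewrite ?ap ?pb' ?pp; case: (i < p) => //= _.
all: clear; rewrite !cycE; lia.
Qed.

End Words.

(** * Gathering a word around a centre *)

Section Straighten.
Variables (n : nat) (i : 'I_n).
Implicit Types (e f g h : 'I_n * 'I_n) (s t c : seq ('I_n * 'I_n)).

Definition central e := (e.1 < e.2) && ((e.1 == i) || (e.2 == i)).
(** Only words of central and straddling letters are considered, because for
these the moves towards the centre i need no choice. *)
Definition straddling e := e.1 < i < e.2.

(** Rewriting that keeps the number of letters and creates no new straddling
letter. *)
Definition reduces s s' : Prop :=
  [/\ rewrites s s', size s' = size s,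
      {in s', forall e, straddling e -> e \in s} & all (predU central straddling) s -> all (predU central straddling) s'] /\
  (has central s -> has central s').

Lemma reduces_refl s : reduces s s.
Proof. by split=> //; split. Qed.

Lemma reduces_trans s2 s1 s3 : reduces s1 s2 -> reduces s2 s3 -> reduces s1 s3.
Proof.
move=> [[r12 z12 n12 a12] c12] [[r23 z23 n23 a23] c23]; split; last by auto.
split; first exact: rewrites_trans r12 r23.
- by rewrite z23.
- by move=> e /n23 h ne; apply: n12 (h ne) ne.
- by auto.
Qed.

Lemma reduces_cat s s' t t' : reduces s s' -> reduces t t' -> reduces (s ++ t) (s' ++ t').
Proof.
move=> [[r z m a] c] [[r' z' m' a'] c']; split; last first.
  by rewrite !has_cat => /orP[/c->|/c'->]; rewrite ?orbT.
split; first exact: rewrites_cat.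
- by rewrite !size_cat z z'.
- by move=> e; rewrite !mem_cat => /orP[/m h /h ->|/m' h /h ->]; rewrite ?orbT.
- by rewrite !all_cat => /andP[/a-> /a'->].
Qed.

Lemma reduces_cons e s s' : reduces s s' -> reduces (e :: s) (e :: s').
Proof. exact: (reduces_cat (reduces_refl [:: e])). Qed.

Lemma reduces_swap e f : disj e f -> reduces [:: e; f] [:: f; e].
Proof.
move=> d; split; last by rewrite /= !orbF orbC.
split=> //; first exact: rewrites_comm.
- by move=> x; rewrite !inE orbC.
- by rewrite /= !andbT andbC.
Qed.

Lemma central_straddling e : central e -> straddling e = false.
Proof. by case/andP => _ /orP[/eqP ei|/eqP ei]; rewrite /straddling ei ltnn ?andbF. Qed.

(** A straddling letter next to a central letter with which it shares a position
becomes central by [star_moves]. *)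
Lemma reduces_conv e f : straddling e -> central f -> ~~ disj e f ->
  (exists2 s, all central s & reduces [:: e; f] s) /\ (exists2 s, all central s & reduces [:: f; e] s).
Proof.
case: e f => [a b] [p q]; rewrite /straddling /= => /andP[ai ib] /andP[/= pq piq] nd.
have [c1 c2 c3 c4] := star_moves ai ib.
have mk e f g h : rewrites [:: e; f] [:: g; h] -> all central [:: g; h] ->
    exists2 s, all central s & reduces [:: e; f] s.
  move=> r ac; exists [:: g; h] => //; move/and3P: (ac) => [cg ch _].
  split; last by rewrite /= cg.
  split=> //; last by rewrite /= cg ch.
  by move=> x; rewrite !inE => /orP[/eqP->|/eqP->]; rewrite central_straddling.
have ci : central (a, i) by rewrite /central /= ai eqxx orbT.
have cb : central (i, b) by rewrite /central /= ib eqxx.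
case/orP: piq => /eqP e.
  have qb : q = b.
    move: nd; rewrite e /disj -!val_eqE /= => nd; apply: val_inj => /=.
    by move: pq nd; rewrite e /=; lia.
  rewrite {}e {}qb in pq nd *; split.
    by apply: (mk _ _ _ _ c2); rewrite /= ?ci ?cb.
  by apply: (mk _ _ _ _ c4); rewrite /= ?ci ?cb.
have pa : p = a.
  move: nd; rewrite e /disj -!val_eqE /= => nd; apply: val_inj => /=.
  by move: pq nd; rewrite e /=; lia.
rewrite {}e {}pa in pq nd *; split.
  by apply: (mk _ _ _ _ c1); rewrite /= ?ci ?cb.
by apply: (mk _ _ _ _ c3); rewrite /= ?ci ?cb.
Qed.

Lemma pass_right e c : straddling e -> all central c ->
  (exists2 s, all central s & reduces (e :: c) s) \/
  (all (disj e) c /\ reduces (e :: c) (c ++ [:: e])).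
Proof.
move=> ne; elim: c => [|f c IH]; first by right; split=> //; apply: reduces_refl.
case/andP => cf cc; have [d|nd] := boolP (disj e f); last first.
  left; have [[s cs gs] _] := reduces_conv ne cf nd; exists (s ++ c).
    by rewrite all_cat cs.
  exact: (reduces_cat gs (reduces_refl c)).
have g : reduces (e :: f :: c) (f :: e :: c) by apply: (reduces_cat (reduces_swap d) (reduces_refl c)).
case: (IH cc) => [[s cs gs]|[ds gs]]; [left; exists (f :: s)|right; split].
- by rewrite /= cf.
- by apply: reduces_trans g _; apply: reduces_cons.
- by rewrite /= d.
- by apply: reduces_trans g _; apply: reduces_cons.
Qed.

Lemma pass_left e c : straddling e -> all central c ->
  (exists2 s, all central s & reduces (c ++ [:: e]) s) \/
  (all (disj e) c /\ reduces (c ++ [:: e]) (e :: c)).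
Proof.
move=> ne; elim/last_ind: c => [|c f IH]; first by right; split=> //; apply: reduces_refl.
rewrite all_rcons => /andP[cf cc]; rewrite -cats1 -catA.
have [d|nd] := boolP (disj e f); last first.
  left; have [_ [s cs gs]] := reduces_conv ne cf nd; exists (c ++ s).
    by rewrite all_cat cs cc.
  exact: (reduces_cat (reduces_refl c) gs).
have g : reduces (c ++ [:: f; e]) ((c ++ [:: e]) ++ [:: f]).
  by rewrite -catA; apply: (reduces_cat (reduces_refl c)); apply: reduces_swap; rewrite disjC.
case: (IH cc) => [[s cs gs]|[ds gs]]; [left; exists (s ++ [:: f])|right; split].
- by rewrite all_cat cs /= cf.
- by apply: reduces_trans g _; apply: reduces_cat gs (reduces_refl _).
- by rewrite all_cat ds /= d.
- by apply: reduces_trans g _; apply: reduces_cat gs (reduces_refl [:: f]).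
Qed.

Lemma count_straddling_central c : all central c -> count straddling c = 0.
Proof.
move=> cc; apply/eqP; rewrite -leqn0 leqNgt -has_count; apply/hasPn => e /(allP cc).
by move/central_straddling->.
Qed.

(** Push the straddling letters to the right through the central ones; either
all get through or one becomes central. *)
Lemma gather s : all (predU central straddling) s ->
  exists s', reduces s s' /\ (count straddling s' < count straddling s \/
    count straddling s' = count straddling s /\
    exists c t, [/\ s' = c ++ t, all central c & all straddling t]).
Proof.
elim: s => [|e s IH] /=.
  by exists [::]; split; [exact: reduces_refl|right; split=> //; exists [::], [::]].
case/andP => he /IH[s' [gs [lt|[eqn [c [t [es cc nt]]]]]]].
  by exists (e :: s'); split; [exact: reduces_cons|left => /=; rewrite ltn_add2l].
subst s'.
case: (boolP (central e)) he => [ce _|_ /= ne].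
  exists (e :: c ++ t); split; first exact: reduces_cons.
  by right; split; [rewrite /= eqn|exists (e :: c), t; rewrite /= ce].
have g : reduces (e :: s) ((e :: c) ++ t) by apply: reduces_cons.
move: eqn; rewrite count_cat count_straddling_central // add0n => eqn.
case: (pass_right ne cc) => [[c' cc' gc]|[_ gc]].
  exists (c' ++ t); split; first by apply: reduces_trans g _; apply: reduces_cat gc (reduces_refl _).
  by left; rewrite count_cat count_straddling_central // ne eqn.
exists ((c ++ [:: e]) ++ t); split; first by apply: reduces_trans g _; apply: reduces_cat gc (reduces_refl _).
right; split; first by rewrite !count_cat count_straddling_central //= ne eqn.
by exists c, (e :: t); rewrite -catA /= ne.
Qed.

(** Push the straddling letters back to the left; a letter that meets the
central block is converted there. *)
Lemma separate c t : all central c -> all straddling t ->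
  (exists2 s, reduces (c ++ t) s & count straddling s < count straddling (c ++ t)) \/
  {in t, forall e, all (disj e) c}.
Proof.
move=> cc; elim: t => [|e t IH] /=; first by right.
case/andP => ne nt; have -> : c ++ e :: t = (c ++ [:: e]) ++ t by rewrite -catA.
case: (pass_left ne cc) => [[c' cc' gc]|[de gc]].
  left; exists (c' ++ t); first by apply: reduces_cat gc (reduces_refl _).
  by rewrite !count_cat (count_straddling_central cc) (count_straddling_central cc') /= ne; lia.
case: (IH nt) => [[s gs lt]|d].
  left; exists (e :: s).
    by apply: reduces_trans (reduces_cat gc (reduces_refl _)) _; apply: reduces_cons.
  by move: lt; rewrite !count_cat /= ne; lia.
by right=> f; rewrite inE => /orP[/eqP->|/d].
Qed.

(** Every conversion lowers the number of straddling letters, so in the end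
those that remain are disjoint from the central ones. *)
Lemma star_normal s : all (predU central straddling) s ->
  exists c t, [/\ reduces s (c ++ t), all central c, all straddling t & {in t, forall e, all (disj e) c}].
Proof.
have [N] := ubnP (count straddling s); elim: N s => // N IH s; rewrite ltnS => le ok.
have [s1 [g1 h1]] := gather ok.
have ok1 : all (predU central straddling) s1 by case: g1 => -[_ _ _ a] _; apply: a.
have rec s2 : reduces s s2 -> count straddling s2 < count straddling s ->
   exists c t, [/\ reduces s (c ++ t), all central c, all straddling t & {in t, forall e, all (disj e) c}].
  move=> g lt; have ok2 : all (predU central straddling) s2 by case: g => -[_ _ _ a] _; apply: a.
  have [|c [t [g' cc nt d]]] := IH s2 _ ok2; first exact: leq_trans lt le.
  by exists c, t; split=> //; apply: reduces_trans g g'.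
case: h1 => [|[eqn [c [t [es cc nt]]]]]; first exact: rec g1.
case: (separate cc nt) => [[s2 g2 lt]|d].
  have g : reduces s s2 by apply: reduces_trans g1 _; rewrite es.
  by apply: (rec s2 g); rewrite -eqn es.
by exists c, t; split=> //; rewrite -es.
Qed.

End Straighten.

(** * Absolute length and cycles *)

Section Cycles.
Variable n : nat.
Implicit Types (g h u : 'S_n) (C : {set 'I_n}).

Lemma porbit_gt1 g p : (1 < #|porbit g p|) = (g p != p).
Proof.
apply/idP/idP => [|ne]; last first.
  apply: leq_trans (_ : #|[set p; g p]| <= _); first by rewrite cards2 eq_sym ne.
  apply/subset_leq_card/subsetP => q; rewrite !inE => /orP[/eqP->|/eqP->].
    exact: porbit_id.
  by have := mem_porbit g 1 p; rewrite expg1.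
apply: contraTN => /eqP e; rewrite -leqNgt.
apply: leq_trans (_ : #|[set p]| <= _); last by rewrite cards1.
apply/subset_leq_card/subsetP => q /porbitP[m ->]; rewrite inE; apply/eqP.
by rewrite permX; elim: m => //= m ->.
Qed.

(** The orbits with one element are the fixed points. *)
Lemma abslen_supp g : abslen g = #|supp g| - ncycles g.
Proof.
pose nt := [set C in porbits g | 1 < #|C|].
have fixE : porbits g :\: nt = [set porbit g p | p in ~: supp g].
  apply/setP => C; rewrite !inE; apply/idP/imsetP.
    case/andP => + Cp; rewrite Cp /= => C1; case/imsetP: Cp => p _ eC.
    exists p => //; rewrite !inE negbK; move: C1.
    by rewrite eC porbit_gt1 negbK.
  case=> p; rewrite !inE negbK => gp ->.
  by rewrite imset_f // porbit_gt1 gp.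
have cf : #|porbits g :\: nt| = #|~: supp g|.
  rewrite fixE card_in_imset // => p q; rewrite !inE !negbK => gp gq e.
  have : p \in porbit g q by rewrite -e porbit_id.
  by move=> /porbitP[m ->]; rewrite permX; elim: m => //= m ->; apply/eqP.
have := cardsID nt (porbits g); rewrite cf (setIidPr _); last first.
  by apply/subsetP => C; rewrite inE => /andP[].
have := cardsC (supp g); rewrite card_ord /abslen /ncycles -/nt.
lia.
Qed.

Lemma porbit_conj g u p : porbit (g ^ u) (u p) = u @: porbit g p.
Proof.
apply/setP => q; apply/porbitP/imsetP => [[m ->]|[_ /porbitP[m ->] ->]].
  by exists ((g ^+ m)%g p); rewrite ?mem_porbit // -conjXg permJ.
by exists m; rewrite -conjXg permJ.
Qed.

Lemma supp_conj g u : supp (g ^ u) = u @: supp g.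
Proof.
apply/setP => q; rewrite -(permKV u q); rewrite mem_imset; last exact: perm_inj.
by rewrite !inE permJ (inj_eq perm_inj).
Qed.

Lemma ncycles_conj g u : ncycles (g ^ u) = ncycles g.
Proof.
have inj : injective (fun C : {set 'I_n} => u @: C) by apply: imset_inj; exact: perm_inj.
rewrite /ncycles -[RHS](card_imset _ inj); congr #|pred_of_set _|.
apply/setP => C; rewrite inE; apply/andP/imsetP => [[/imsetP[q _ ->] c1]|[C' + ->]].
  move: c1; rewrite -(permKV u q) porbit_conj card_imset; last exact: perm_inj.
  by move=> c1; exists (porbit g ((u^-1)%g q)); rewrite // inE c1 imset_f.
rewrite inE => /andP[/imsetP[p _ ->] c1]; rewrite card_imset; last exact: perm_inj.
by rewrite -porbit_conj imset_f.
Qed.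

Lemma abslen_conj g u : abslen (g ^ u) = abslen g.
Proof. by rewrite !abslen_supp supp_conj ncycles_conj card_imset //; exact: perm_inj. Qed.

Lemma abslen_inv g : abslen g^-1 = abslen g.
Proof. by rewrite /abslen porbitsV. Qed.

Lemma abslen_tpermr g i j : abslen (g * tperm i j)%g <= (abslen g).+1.
Proof. by rewrite -abslen_inv invMg tpermV -(abslen_inv g) abslen_tperm. Qed.

(** The nontrivial cycles of h remain cycles of the product, and g moves a point
outside all of them. *)
Lemma ncycles_disjoint g h : g != 1%g -> (forall p, h p != p -> g p = p) ->
  ncycles h < ncycles (h * g).
Proof.
move=> g1 d; have [f fE fe] : exists2 f : 'S_n, forall p, f p = g (h p) & (h * g)%g = f.
  by exists (h * g)%g => // p; rewrite permM.
rewrite {}fe.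
have hs p : h p != p -> h (h p) != h p by rewrite (inj_eq perm_inj).
have iter m p : h p != p -> (h ^+ m)%g p = (f ^+ m)%g p /\ h ((h ^+ m)%g p) != (h ^+ m)%g p.
  move=> hp; elim: m => [|m [IH1 IH2]]; first by rewrite !expg0 !perm1.
  rewrite !expgSr !permM -IH1 fE; split; last exact: hs.
  by rewrite (d (h _)) //; apply: hs.
have orb p : h p != p -> porbit f p = porbit h p.
  move=> hp; apply/setP => q; apply/porbitP/porbitP => -[m ->]; exists m; by case: (iter m p hp).
have [q gq] : exists q, g q != q.
  apply/existsP; rewrite -negb_forall; apply: contra g1 => /forallP all_fix.
  by apply/eqP/permP => p; rewrite perm1; apply/eqP.
have hq : h q = q by apply/eqP; apply: contraNT gq => /d ->.
have fq : f q != q by rewrite fE hq.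
apply: proper_card; apply/properP; split.
  apply/subsetP => C; rewrite !inE => /andP[/imsetP[p _ ->]]; rewrite porbit_gt1 => hp.
  by rewrite -orb // imset_f //= porbit_gt1; case: (iter 1 p hp); rewrite !expg1 => <-.
exists (porbit f q); rewrite !inE; first by rewrite imset_f // porbit_gt1.
apply/negP => /andP[/imsetP[p _ e]]; rewrite e porbit_gt1 => hp.
have : q \in porbit h p by rewrite -e porbit_id.
by case/porbitP => m eq; case: (iter m p hp) => _; rewrite -eq hq eqxx.
Qed.

End Cycles.

(** * Decomposition into disjoint stars *)

Section Blocks.
Variable n : nat.
Implicit Types (e : 'I_n * 'I_n) (s t c : seq ('I_n * 'I_n)) (x : Snq n).

(** The first letter of the word is the last factor: the word acts on positions,
and the product of permutations applies its left factor first. *)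
Definition word_perm s : 'S_n := foldr (fun e g => g * tperm e.1 e.2)%g 1%g s.

Lemma endpt_word x s : (endpt x s).2 = (word_perm s * x.2)%g.
Proof. by elim: s x => [|e s IH] x /=; rewrite ?mul1g // IH mulgA. Qed.

Lemma word_perm_cat s t : word_perm (s ++ t) = (word_perm t * word_perm s)%g.
Proof. by elim: s => [|e s IH] /=; rewrite ?mulg1 // IH mulgA. Qed.

Lemma abslen_word g s : abslen (g * word_perm s)%g <= abslen g + size s.
Proof.
elim: s => [|e s IH] /=; first by rewrite mulg1 addn0.
by rewrite mulgA addnS; apply: leq_trans (abslen_tpermr _ _ _) _.
Qed.

Lemma abslen1 : abslen (1%g : 'S_n) = 0.
Proof. by rewrite abslen_supp; apply/eqP; rewrite subn_eq0 -/(supp _) (_ : supp _ = set0) ?cards0 //;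
  apply/setP => p; rewrite !inE perm1 eqxx. Qed.

Lemma abslen_word_size s : abslen (word_perm s) <= size s.
Proof. by have := abslen_word 1%g s; rewrite mul1g abslen1. Qed.

Lemma word_perm_fix s p : all (fun e => (e.1 != p) && (e.2 != p)) s -> word_perm s p = p.
Proof.
elim: s => [|e s IH] /=; first by rewrite perm1.
by case/andP => /andP[e1 e2] /IH h; rewrite permM h tpermD.
Qed.

(** A letter is a transposition together with the one of its ends that is its
centre. *)
Definition star (q : nat * ('I_n * 'I_n)) : bool :=
  (q.2.1 == q.1 :> nat) || (q.2.2 == q.1 :> nat).

Lemma words_top_nseq (g : nat -> nat -> seq (seq nat)) k m r j (s : seq nat) : s \in g m r ->
  nseq j.+1 k ++ s \in words_top g k m.+1 (j.+1 + r).
Proof.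
move=> sg; elim: j => [|j IH] /=; apply: (map_f (cons k)); rewrite mem_cat.
  by rewrite sg.
by rewrite IH orbT.
Qed.

(** At each step the centre is the largest left end B of a word all of whose
transpositions exchange a position <= B with one > B, so [star_normal] applies
and leaves a word with left ends < B.  A word that attains the absolute length
has no factor with trivial product; therefore each star adds a cycle. *)
Lemma blocks B s x : valid x s -> all (fun e => e.1 < B <= e.2) s ->
  abslen (word_perm s) = size s ->
  exists (z : seq (nat * ('I_n * 'I_n))) (m : nat),
    [/\ valid x (unzip2 z), endpt x (unzip2 z) = endpt x s, all star z,
        unzip1 z \in words B m (size s) & m <= ncycles (word_perm s)].
Proof.
elim: B s x => [|B IH] s x vs ks ms.
  case: s vs ks ms => [|e s] //= _ _ _; exists [::], 0; split=> //.
have [hasB|noB] := boolP (has (fun e => e.1 == B :> nat) s); last first.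
  have ks' : all (fun e => e.1 < B <= e.2) s.
    apply/allP => e es; have := allP ks e es; have /= := hasPn noB e es; lia.
  have [z [m [vz ez sz wz mz]]] := IH s x vs ks' ms.
  by exists z, m; split=> //=; rewrite mem_cat wz.
have [i iB] : exists i : 'I_n, i = B :> nat.
  by case/hasP: hasB => e _ /eqP eB; exists e.1.
have ok : all (predU (central i) (straddling i)) s.
  apply/allP => e es; have := allP ks e es; rewrite /= /central /straddling -!val_eqE /= iB; lia.
have hc : has (central i) s.
  case/hasP: hasB => e es /eqP eB; apply/hasP; exists e => //.
  by have := allP ks e es; rewrite /central -!val_eqE /= iB; lia.
have [c [t [[[r st nt _] hct] cc tt d]]] := star_normal ok.
have [vct ect] := r x vs.
have prE : word_perm s = (word_perm t * word_perm c)%g.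
  have := congr1 (fun y : Snq n => y.2) ect; rewrite !endpt_word word_perm_cat.
  by move/mulIg.
have c0 : c != [::].
  apply: contraTneq (hct hc) => -> /=.
  apply/hasPn => e et; apply/negP => /central_straddling; by rewrite (allP tt).
have mt : abslen (word_perm t) = size t.
  have := abslen_word (word_perm t) c; have := abslen_word_size t; rewrite -prE ms -st size_cat; lia.
have g1 : word_perm c != 1%g.
  apply/eqP => e; move: (abslen_word_size t) ms; rewrite prE e mulg1 -st size_cat.
  by case: c c0 {cc d r st nt hct vct ect prE e} => //= f c _; lia.
(* the remaining letters share no position with the star *)
have dis_ct p : word_perm t p != p -> word_perm c p = p.
  move=> tp; apply: word_perm_fix; apply/allP => e ec; apply/negPn/negP => ne.
  case/eqP: tp; apply: word_perm_fix; apply/allP => f ft.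
  have /and4P[d1 d2 d3 d4] := allP (d f ft) e ec.
  move: ne; rewrite negb_and !negbK => /orP[/eqP<-|/eqP<-]; first by rewrite d1 d3.
  by rewrite d2 d4.
move: vct; rewrite valid_cat => /andP[vc vt].
have kt : all (fun e => e.1 < B <= e.2) t.
  by apply/allP => e et; have := allP tt e et; rewrite /straddling iB => /andP[-> /ltnW].
have [z [m [vz ez sz wz mz]]] := IH t (endpt x c) vt kt mt.
exists ([seq (B, e) | e <- c] ++ z), m.+1.
have u2 : unzip2 ([seq (B, e) | e <- c] ++ z) = c ++ unzip2 z.
  by rewrite /unzip2 map_cat -map_comp map_id_in.
have u1 : unzip1 ([seq (B, e) | e <- c] ++ z) = nseq (size c) B ++ unzip1 z.
  rewrite /unzip1 map_cat -map_comp; congr (_ ++ _).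
  by elim: (c) => //= f c' ->.
split.
- by rewrite u2 valid_cat vc.
- by rewrite u2 endpt_cat ez -endpt_cat ect.
- rewrite all_cat sz andbT all_map; apply/allP => e ec /=.
  have /andP[_] := allP cc e ec; by rewrite -!val_eqE /= iB.
- rewrite u1 /= mem_cat -st size_cat; apply/orP; right.
  by case: c c0 {cc d r st nt hct vc vt ect prE g1 dis_ct u1 u2 vz ez} => //= f c _; exact: words_top_nseq.
- apply: leq_ltn_trans mz _; rewrite prE; exact: ncycles_disjoint.
Qed.

End Blocks.

(** * Signs of the contributing words *)

Import Num.Theory Order.TTheory.

Lemma words_top_spec k m r g s :
  (forall m' r' s', s' \in g m' r' -> [/\ size s' = r', all (ltn^~ k) s' & size (undup s') = m']) ->
  s \in words_top g k m r -> [/\ size s = r, all (ltn^~ k.+1) s, k \in s & size (undup s) = m].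
Proof.
move=> hg; elim: r m s => [|r IH] [|m] s //= /mapP[t + ->].
rewrite mem_cat => /orP[/hg[sz al un]|/IH[sz al kt un]] /=.
  split; rewrite ?sz ?ltnSn ?inE ?eqxx //=.
    by apply: sub_all al => x /= /ltnW.
  by case: ifP => [/(allP al)|_] /=; rewrite ?ltnn ?un.
by split; rewrite ?sz ?ltnSn ?inE ?eqxx ?kt.
Qed.

Lemma words_spec k m r s : s \in words k m r ->
  [/\ size s = r, all (ltn^~ k) s & size (undup s) = m].
Proof.
elim: k m r s => [|k IH] m r s /=.
  by case: ifP => // /andP[/eqP-> /eqP->]; rewrite inE => /eqP->.
rewrite mem_cat => /orP[/IH[sz al un]|/(words_top_spec IH)[sz al _ un]]; split=> //.
by apply: sub_all al => x /= /ltnW.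
Qed.

Section Lift.
Variable n : nat.
Implicit Types (x y : Snq n) (e : 'I_n * 'I_n) (s : seq ('I_n * 'I_n)) (p : 'I_n).

(** The exponent of q_(m+1), extended by 0 to all m. *)
Definition qdeg (al : 'X_{1..n.-1}) (m : nat) : nat :=
  if insub m is Some o then al o else 0.

Lemma qdeg_step x i j m :
  qdeg (qstep x (i, j)).1 m = qdeg x.1 m + ((x.2 j < x.2 i) && (i <= m < j)).
Proof.
rewrite /qdeg; case: insubP => [o _ om|nm].
  by rewrite mnmDE wrapqE /= -om.
have : ~~ (m < j) by have := ltn_ord j; lia.
by move/negbTE->; rewrite !andbF.
Qed.

Local Open Scope ring_scope.

(** The value at p, counted on a line instead of a circle: it follows the values
taken at p along a chain, with n added each time that one passes from the
largest value to the smallest, whence the difference of exponents. *)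
Definition lift x p : int :=
  (x.2 p : nat)%:Z + n%:Z * ((qdeg x.1 p)%:Z - (if (p : nat) is q.+1 then qdeg x.1 q else 0%N)%:Z).

(** The left end of a transposition receives a cyclically larger value and the
right end a smaller one, by opposite amounts; the power of q records the passage
through n. *)
Lemma lift_step x i j p : admissible x.2 (i, j) -> exists2 d : int, 0 < d &
  lift (qstep x (i, j)) p = lift x p + (if p == i then d else if p == j then - d else 0).
Proof.
move=> h; have ij := admissible_lt h; have vij := val_neq x.2 (_ : i != j).
have {}vij : x.2 i != x.2 j :> nat by apply: vij; rewrite neq_ltn ij.
exists ((x.2 j)%:Z - (x.2 i)%:Z + n%:Z * (x.2 j < x.2 i)%N%:Z).
  by have := ltn_ord (x.2 i); have := ltn_ord (x.2 j); move: vij; case: (ltnP (x.2 j) (x.2 i)) => /=; lia.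
have E : (nat_of_ord ((qstep x (i, j)).2 p))%:Z =
   (if p == i then x.2 j : nat else if p == j then x.2 i : nat else x.2 p)%:Z by rewrite /= swap_pos_val.
rewrite /lift E qdeg_step.
have -> : (if (p : nat) is q.+1 then qdeg (qstep x (i, j)).1 q else 0%N) =
   ((if (p : nat) is q.+1 then qdeg x.1 q else 0) + ((x.2 j < x.2 i) && (i < p <= j)))%N.
  by case: (p : nat) => [|q]; rewrite ?andbF // qdeg_step ltnS.
set a := qdeg _ _; set b := (X in (X + _)%N).
have [pi|pi] := eqVneq p i.
  by rewrite pi leqnn ij ltnn andbT andbF /=; case: (x.2 j < x.2 i)%N; ring.
have [pj|pj] := eqVneq p j.
  by rewrite pj leqnn ij ltnn !andbT !andbF; case: (x.2 j < x.2 i)%N => /=; ring.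
have -> : (i <= p < j)%N = (i < p <= j)%N by move: pi pj; rewrite -!val_eqE /=; lia.
by rewrite !PoszD; ring.
Qed.

Lemma lift_up x s p : valid x s -> all (fun e => e.2 != p) s ->
  lift x p <= lift (endpt x s) p /\
  (has (fun e => e.1 == p) s -> lift x p < lift (endpt x s) p).
Proof.
elim: s x => [|[i j] s IH] x //= /andP[h /IH{}IH] /andP[jp /IH[le lt]].
have [d d0 E] := lift_step p h; rewrite -/(endpt _ _).
have {}E : lift x p <= lift (qstep x (i, j)) p /\ (i == p -> lift x p < lift (qstep x (i, j)) p).
  rewrite E (eq_sym p i) (eq_sym p j) (negbTE jp); case: (i == p) => //=; last by rewrite addr0.
  by rewrite ltrDl d0 lerDl ltW.
case: E => E1 E2; split; first exact: le_trans E1 le.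
case/orP => [/E2 h'|/lt h']; [exact: lt_le_trans h' le|exact: le_lt_trans E1 h'].
Qed.

Lemma lift_down x s p : valid x s -> all (fun e => e.1 != p) s ->
  lift (endpt x s) p <= lift x p /\
  (has (fun e => e.2 == p) s -> lift (endpt x s) p < lift x p).
Proof.
elim: s x => [|[i j] s IH] x //= /andP[h /IH{}IH] /andP[ip /IH[le lt]].
have [d d0 E] := lift_step p h; rewrite -/(endpt _ _).
have {}E : lift (qstep x (i, j)) p <= lift x p /\ (j == p -> lift (qstep x (i, j)) p < lift x p).
  rewrite E (eq_sym p i) (eq_sym p j) (negbTE ip); case: (j == p) => //=; last by rewrite addr0.
  by rewrite gtrDl oppr_lt0 d0 gerDl oppr_le0 ltW.
case: E => E1 E2; split; first exact: le_trans le E1.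
case/orP => [/E2 h'|/lt h']; [exact: le_lt_trans le h'|exact: lt_le_trans h' E1].
Qed.

End Lift.

Section Coherence.
Variables (n : nat).
Notation letter := (nat * ('I_n * 'I_n))%type.
Implicit Types (z : seq letter) (q : letter) (e : 'I_n * 'I_n) (p : 'I_n).

Definition leaf q : 'I_n := if q.2.1 == q.1 :> nat then q.2.2 else q.2.1.
Definition neg q : bool := q.2.2 == q.1 :> nat.
Definition sgn z : int := (\prod_(q <- z) (if neg q then -1 else 1))%R.

Lemma sgnE z : sgn z = ((-1) ^+ count neg z)%R.
Proof.
rewrite /sgn; elim: z => [|q z IH]; rewrite ?big_nil ?expr0 // big_cons IH /=.
by case: (neg q); rewrite ?mul1r // exprS.
Qed.

Lemma moved_touched (x : Snq n) z (p : 'I_n) : all (@star n) z ->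
  (endpt x (unzip2 z)).2 p != x.2 p -> (p : nat) \in undup (unzip1 z) ++ map (fun q => leaf q : nat) z.
Proof.
move=> sz; apply: contraR => no; rewrite endpt_word permM word_perm_fix //.
rewrite all_map; apply/allP => q qz /=; have sq := allP sz q qz.
move: no; rewrite mem_cat mem_undup negb_or => /andP[n1 n2].
have c1 : (q.1 != p :> nat) by apply: contraNneq n1 => <-; apply: map_f.
have c2 : (leaf q != p :> nat) by apply: contraNneq n2 => <-; apply: (map_f (fun q => leaf q : nat)).
move: c1 c2 sq; rewrite /leaf /star -!val_eqE /=.
have [->|_] := eqVneq (nat_of_ord q.2.1) q.1; first by move=> -> ->.
by move=> c1 c2 /eqP->; rewrite c1 c2.
Qed.

(** All the positions touched by the word z are moved, and they are as many as
its centres and its leaves; hence every leaf occurs once, and its [lift] goes up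
exactly when it lies to the left of its centre.  Among the moved positions, the
lift goes up along the chain s exactly at those < k.  So the leaves that
contribute a sign are the moved positions < k that are not centres. *)
Lemma sign_coherent (k m : nat) (x y : Snq n) s z :
  valid x s -> endpt x s = y -> all (fun e => e.1 < k <= e.2) s ->
  valid x (unzip2 z) -> endpt x (unzip2 z) = y -> all (@star n) z ->
  unzip1 z \in words k m (size z) ->
  m + size z <= #|[set p | y.2 p != x.2 p]| ->
  count neg z = #|[set p : 'I_n | (p < k) && (y.2 p != x.2 p)]| - m.
Proof.
move=> vs es ks vz ez sz /words_spec[_ ck um] big.
set P := [set p | _] in big *.
pose T := undup (unzip1 z) ++ map (fun q => leaf q : nat) z.
pose L := map val (enum P).
have szT : size T = m + size z by rewrite size_cat um size_map.
have szL : size L = #|P| by rewrite size_map -cardE.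
have uL : uniq L by rewrite map_inj_uniq ?enum_uniq //; exact: val_inj.
have sub : {subset L <= T}.
  move=> _ /mapP[p + ->]; rewrite mem_enum inE => hp.
  by apply: (@moved_touched x) => //; rewrite ez.
have le : size T <= size L by rewrite szT szL.
have uT : uniq T by apply: leq_size_uniq uL sub le.
(* the bound on the number of moved positions leaves no room for repetitions *)
have LT : perm_eq L T.
  by apply: uniq_perm => //; case: (uniq_min_size uL sub le).
have cz : count (fun q => leaf q < k) z = count neg z.
  apply: eq_in_count => q qz; have sq := allP sz q qz.
  move: (uT); rewrite cat_uniq => /and3P[_ hs ul].
  have lc q' : q' \in z -> leaf q != q'.1 :> nat.
    move=> qz'; apply/eqP => e; move/hasPn: hs => /(_ (leaf q : nat)).
    by rewrite (map_f (fun q => leaf q : nat)) // mem_undup e map_f // => /(_ isT).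
  have ll q' : q' \in z -> leaf q' = leaf q -> q' = q.
    move: ul; case/splitPr: qz => z1 z2; rewrite map_cat /= uniq_catC /= mem_cat.
    case/andP => nin _; rewrite mem_cat inE => /or3P[h|/eqP//|h] e.
      by case/negP: nin; rewrite -e (map_f (fun q => leaf q : nat) h) orbT.
    by case/negP: nin; rewrite -e (map_f (fun q => leaf q : nat) h).
  have leafE : leaf q = if neg q then q.2.1 else q.2.2.
    have := lc q qz; move: sq; rewrite /leaf /neg /star.
    by case: eqP => //= _; case: eqP.
  case: (boolP (neg q)) leafE => hn lE.
    have up := @lift_up n x (unzip2 z) (leaf q) vz.
    case: up => [|_ up].
      rewrite all_map; apply/allP => q' qz' /=; apply/eqP => e.
      have qq : q' = q.
        apply: ll => //; have := lc q' qz'; rewrite -e; have := allP sz q' qz'.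
        by rewrite /leaf /star; case: eqP => //= _ /eqP->; rewrite eqxx.
      by have := lc q qz; rewrite -e qq (eqP hn) eqxx.
    have {up} := up _; rewrite ez => lt.
    apply: contraTT isT => /=; rewrite -leqNgt => kl.
    have [|ge _] := @lift_down n x s (leaf q) vs.
      by apply: sub_all ks => e /andP[ek _]; rewrite -val_eqE neq_ltn (leq_trans ek kl).
    move: ge; rewrite es leNgt lt //.
    by apply/hasP; exists q.2; [apply: map_f|rewrite lE].
  have down := @lift_down n x (unzip2 z) (leaf q) vz.
  apply/negbTE/negP => kl; case: down => [|_ down].
    rewrite all_map; apply/allP => q' qz' /=; apply/eqP => e.
    have qq : q' = q.
      apply: ll => //; have := lc q' qz'; rewrite -e /leaf => h.
      by rewrite (negbTE h).
    have := lc q qz; rewrite -e qq; move: sq hn; rewrite /star /neg.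
    by case: eqP => //= _ ->.
  have [|ge _] := @lift_up n x s (leaf q) vs.
    by apply: sub_all ks => e /andP[_ ek]; rewrite -val_eqE neq_ltn (leq_trans kl ek) orbT.
  move: ge; rewrite es leNgt -ez down //.
  by apply/hasP; exists q.2; [apply: map_f|rewrite lE].
have -> : #|[set p : 'I_n | (p < k) && (y.2 p != x.2 p)]| = count (ltn^~ k) L.
  rewrite count_map -sum1_count big_enum_cond -sum1_card; apply: eq_bigl => p.
  by rewrite !inE andbC.
rewrite (seq.permP LT) count_cat count_map.
have -> : count (ltn^~ k) (undup (unzip1 z)) = m.
  rewrite -um; apply/eqP; rewrite -all_count; apply/allP => c; rewrite mem_undup; exact: (allP ck).
by rewrite addKn -cz; apply: eq_count.
Qed.
End Coherence.

(** * Coefficients as signed counts of chains *)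

Section Coefficient.
Variables (n : nat) (A : qH_flag n).
Notation letter := (nat * ('I_n * 'I_n))%type.
Implicit Types (x y : Snq n) (z : seq letter) (q : letter) (a : A) (e : 'I_n * 'I_n).
Local Open Scope ring_scope.

Notation S := (@schubert n A).
Notation X := (@chern n A).

Definition qcoef a y : int := (schubert_coord a y.2)@_(y.1).

Lemma qcoef_sum (I : Type) (r : seq I) (P : pred I) (F : I -> A) y :
  qcoef (\sum_(i <- r | P i) F i) y = \sum_(i <- r | P i) qcoef (F i) y.
Proof. by rewrite /qcoef scoord_sum raddf_sum. Qed.

Lemma qcoef_int (c : int) a y : qcoef (c%:~R *: a) y = c * qcoef a y.
Proof. by rewrite /qcoef scoordZ mulrzl raddfMz mulrzz mulrC. Qed.

Lemma qcoef_qS x y : qcoef (qS A x) y = (x == y)%:R.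
Proof.
case: x y => [al u] [be w]; rewrite /qcoef /qS /= scoordZ scoord_S xpair_eqE.
case: (u == w); rewrite ?mulr1 ?mulr0 ?mcoeff0 ?andbF ?andbT // mcoeffX.
by [].
Qed.

Lemma qS_chern_signed x (i : 'I_n) : qS A x * X i =
  \sum_(e | admissible x.2 e && star ((i : nat), e)) (if neg ((i : nat), e) then -1 else 1 : int)%:~R *: qS A (qstep x e).
Proof.
rewrite qS_chern [RHS](bigID (fun e : 'I_n * 'I_n => e.1 == i)) /=; congr (_ + _).
  apply: eq_big => [e|e /andP[h /eqP e1]].
    by rewrite /star /=; case: eqP => [->|_]; rewrite ?andbF ?eqxx ?andbT.
  have ij : (e.1 < e.2)%N by case/andP: h.
  by rewrite /neg /= -e1 (gtn_eqF ij) scale1r.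
rewrite -sumrN; apply: eq_big => [e|e /andP[h /eqP e1]].
  rewrite /star /= -!val_eqE /=; have [adme|] := boolP (admissible x.2 e) => //=.
  have ij : (e.1 < e.2)%N by case/andP: adme.
  by case: (e.2 =P i :> nat) => [<-|_] /=; rewrite ?orbT ?orbF ?andbN // (ltn_eqF ij).
by rewrite /neg /= e1 eqxx scaleN1r.
Qed.

(** The coefficient is the sum of the signs of the words that lead from x to y;
if these signs agree there is no cancellation. *)
Lemma qcoef_coherent (cs : seq nat) x y (eps : int) : all (ltn^~ n) cs ->
  (forall z, unzip1 z = cs -> all (@star n) z -> valid x (unzip2 z) ->
     endpt x (unzip2 z) = y -> sgn z = eps) ->
  0 <= eps * qcoef (qS A x * monomial A cs) y /\
  ((exists z, [/\ unzip1 z = cs, all (@star n) z, valid x (unzip2 z) & endpt x (unzip2 z) = y]) ->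
   0 < eps * qcoef (qS A x * monomial A cs) y).
Proof.
elim: cs x eps => [|c cs IH] x eps /=.
  move=> _ H; rewrite /monomial big_nil mulr1 qcoef_qS; split.
    case: eqP => [e|_]; rewrite ?mulr0 // mulr1.
    by rewrite -(H [::] erefl isT isT e) /sgn big_nil.
  case=> -[|q z] [] // _ _ _ e; rewrite -(H [::] erefl isT isT e) /sgn big_nil.
  by rewrite (e : x = y) eqxx.
case/andP => cn csn H; pose i := Ordinal cn.
have -> : monomial A (c :: cs) = X i * monomial A cs by rewrite /monomial big_cons.
rewrite mulrA qS_chern_signed mulr_suml qcoef_sum mulr_sumr.
pose sg e : int := if neg ((i : nat), e) then -1 else 1.
have sg2 e : sg e * sg e = 1 by rewrite /sg; case: ifP; rewrite ?mulrNN mulr1.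
pose F e := eps * sg e * qcoef (qS A (qstep x e) * monomial A cs) y.
have FE e : eps * qcoef ((sg e)%:~R *: qS A (qstep x e) * monomial A cs) y = F e.
  by rewrite -scalerAl qcoef_int mulrA.
rewrite (eq_bigr F) => [|e _]; last exact: FE.
have IHe e : admissible x.2 e && star ((i : nat), e) -> 0 <= F e /\
   ((exists z, [/\ unzip1 z = cs, all (@star n) z, valid (qstep x e) (unzip2 z)
      & endpt (qstep x e) (unzip2 z) = y]) -> 0 < F e).
  case/andP => h st; apply: IH => // z uz sz vz ez.
  have := H (((i : nat), e) :: z); rewrite /= uz st sz h vz => /(_ erefl isT isT ez) <-.
  by rewrite /sgn big_cons -/(sgn z) -/(sg e) mulrAC sg2 mul1r.
split; first by apply: sumr_ge0 => e /IHe[].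
case=> -[|[c' e] z] [] //= [-> uz] /andP[st sz] /andP[h vz] ez.
rewrite (bigD1 e) /=; last by rewrite h.
apply: ltr_pwDl; last by apply: sumr_ge0 => f /andP[/IHe[]].
by case: (IHe e) => [|_]; [rewrite h|apply; exists z].
Qed.

End Coefficient.

(** * Chains in the quantum k-Bruhat order *)

Section Chains.
Variable n : nat.
Implicit Types (x y : Snq n).

Lemma mdeg_qexp (i j : 'I_n) : mdeg (qexp i j) = j - i.
Proof.
rewrite mdegE (eq_bigr (fun m : 'I_n.-1 => (i <= m < j : nat))); last by move=> m _; rewrite mnmE.
rewrite -(big_mkord xpredT (fun m : nat => (i <= m < j : nat))).
have jn : j <= n.-1 by have := ltn_ord j; lia.
have H b : b <= n.-1 -> \sum_(0 <= m < b) (i <= m < j : nat) = minn b j - i.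
  elim: b => [|b IH] bn; first by rewrite big_nil min0n.
  by rewrite big_nat_recr //= IH ?(ltnW bn) //; lia.
by rewrite H //; lia.
Qed.

Lemma chain_of_qBruhat k x y : qBruhat k x y ->
  exists s : seq ('I_n * 'I_n), [/\ valid x s, endpt x s = y, all (fun e : 'I_n * 'I_n => e.1 < k <= e.2) s
    & qlen y = qlen x + size s].
Proof.
elim=> {x y} [x y|x|x y w _ [s [vs es ks ls]] _ [t [vt et kt lt]]].
- case=> i [j [ik kj ey cov]]; have ij := leq_trans ik kj.
  have : admissible x.2 (i, j) /\ y.1 = (x.1 + wrapq x.2 (i, j))%MM.
    case: cov => -[e1 /eqP e2]; move: e2; rewrite ey.
      rewrite cover_classical // => /andP[h lt]; split=> //.
      by rewrite /wrapq /= ltnNge (ltnW lt) addm0.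
    rewrite cover_quantum // => /andP[h lt]; split=> //.
    by rewrite /wrapq /= lt.
  case=> h e1; exists [:: (i, j)]; rewrite /= h ik kj; split=> //.
    by case: (y) ey e1 => al w /= -> ->.
  rewrite /qlen; case: cov => -[-> e2]; rewrite ?mdegD ?mdeg_qexp; lia.
- by exists [::]; split; rewrite ?addn0.
exists (s ++ t); rewrite valid_cat vs es vt endpt_cat es et all_cat ks kt; split=> //.
by rewrite lt ls size_cat addnA.
Qed.

End Chains.

Theorem theorem5p1 (n k : nat) (k_gt0 : 0 < k) (k_lt_n : k < n)
    (A : qH_flag n) (u w : 'S_n) (alpha : 'X_{1..n.-1})
    (hmin : minimal_interval k u alpha w) :
  exists l : seq nat,
    [/\ is_hook l, fits n k l, sumn l = qlen (alpha, w) - plen u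
      & qLR A u (vperm n k l) alpha w != 0%R].
Proof.
have n1 : 1 < n by apply: leq_ltn_trans k_lt_n.
case: hmin => /chain_of_qBruhat[s [vs es ks ls]] ms.
have rE : qlen (alpha, w) - plen u = size s.
  by rewrite ls /qlen /= mdeg0 muln0 add0n addKn.
have zE : fmul w u^-1%g = (word_perm s ^ u)%g.
  by have := endpt_word (0%MM, u) s; rewrite es /fmul /= => ->; rewrite /conjg mulgA.
have dE : dist u w = size s by rewrite -rE ms -abslen_supp.
(* the end point of s shows that u^-1 w is conjugate to the product of s *)
have aE : abslen (word_perm s) = size s by rewrite -dE -(abslen_conj _ u) -zE.
have nE : size s = #|supp (word_perm s)| - ncycles (word_perm s) by rewrite -abslen_supp.
rewrite rE /qLR; have LRnz v : qcoef (@schubert n A u * @schubert n A v)%R (alpha, w) != 0%R ->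
    ((schubert_coord (@schubert n A u * @schubert n A v) w)@_alpha *: 'X_[alpha] : Zq n)%R != 0%R.
  move=> h; apply: contraNneq h => e; have := congr1 (fun p : Zq n => p@_alpha)%R e.
  by rewrite /= mcoeffZ mcoeffX eqxx mulr1 mcoeff0 /qcoef /= => ->.
have [s0|s_gt0] := posnP (size s).
  move/size0nil: s0 => s0; subst s; exists [:: 0].
  have fit0 : fits n k [:: 0] by rewrite /fits /= k_gt0.
  split=> //; first by split=> //; exists 1, 0.
  have -> : vperm n k [:: 0] = 1%g.
    apply: (grassmannian_unique (vpermP (ltnW k_lt_n) fit0)).
    apply/andP; split; apply/forallP => i.
      by rewrite perm1; case: (k.-1 - i) => [|m]; rewrite /= ?nth_nil addn0 eqxx implybT.
    by apply/forallP => j; rewrite !perm1; apply/implyP => /andP[].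
  apply: LRnz; rewrite (S1 A n1) mulr1 qS0 qcoef_qS.
  by case: es => -> ->; rewrite eqxx.
have [z [m [vz ez sz wz mz]]] := blocks vs ks aE.
have szz : size z = size s by have [<- _ _] := words_spec wz; rewrite size_map.
pose x : Snq n := (0%MM, u); pose y : Snq n := (alpha, w).
have big : m + size s <= #|[set p | y.2 p != x.2 p]|.
  have -> : [set p | y.2 p != x.2 p] = supp (word_perm s).
    apply/setP => p; rewrite !inE -[y]es endpt_word permM /=.
    by rewrite (inj_eq perm_inj).
  by move: nE s_gt0; lia.
(* the common sign of the contributing words, from sign_coherent *)
pose eps : int := ((-1) ^+ (#|[set p : 'I_n | (p < k) && (y.2 p != x.2 p)]| - m)%N)%R.
have coh (cs : seq nat) : cs \in words k m (size s) ->
    (0 <= eps * qcoef (qS A x * monomial A cs) y)%R /\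
    (cs = unzip1 z -> (0 < eps * qcoef (qS A x * monomial A cs) y)%R).
  move=> wcs; have [csz csk _] := words_spec wcs.
  have [||ge gt] := @qcoef_coherent n A cs x y eps.
  - by apply: sub_all csk => c /= /ltn_trans; apply.
  - move=> z' uz sz' vz' ez'; rewrite sgnE; congr (_ ^+ _)%R.
    have zsz : size z' = size s by rewrite -csz -uz size_map.
    by apply: (sign_coherent vs es ks vz' ez' sz'); rewrite zsz // uz.
  split=> // e; apply: gt; exists z; split=> //; by rewrite ez es.
(* the word read off from the stars makes the inequality strict *)
have Gpos : (0 < eps * qcoef (qS A x * msum A k m (size s)) y)%R.
  rewrite /msum mulr_sumr qcoef_sum mulr_sumr.
  rewrite (perm_big _ (perm_to_rem wz)) big_cons /= ltr_pwDl //.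
    by apply: (coh _ wz).2.
  rewrite big_seq; apply: sumr_ge0 => cs /mem_rem wcs; exact: (coh _ wcs).1.
(* the rank equals dist u w, so negligible classes do not contribute *)
have GH : qcoef (qS A x * msum A k m (size s)) y = qcoef (qS A x * hook_sum A k m (size s)) y.
  have := msum_hooks A n1 m s_gt0 k_lt_n; rewrite /negligible => /(_ u w); rewrite dE => /(_ (leqnn _)).
  rewrite mulrBr -scaleN1r scoordD scoordZ mulN1r qS0 => /eqP; rewrite subr_eq0 => /eqP e.
  by rewrite /qcoef e.
have [a hnz] : exists a : 'I_(size s), qcoef (qS A x * hookS A (size s - a) a.+1 k)%R y != 0%R.
  apply/existsP; rewrite -negb_forall; apply: contraTN Gpos => /forallP z0.
  rewrite GH /hook_sum mulr_sumr qcoef_sum big1 ?mulr0 ?ltxx // => a _.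
  by rewrite -scalerAr qcoef_int (eqP (z0 a)) mulr0.
have fit : hook_fits n (size s - a) a.+1 k.
  by apply: contraNT hnz => /hookS_out->; rewrite mulr0 /qcoef scoord0 mcoeff0.
exists (hook (size s - a) a.+1); have as_ := ltn_ord a.
have /and4P[_ ak b0 kb] := fit.
have fitl := fits_hook fit; have /and3P[part _ _] := fitl.
split.
- by split=> //; exists a.+1, (size s - a).
- exact: fitl.
- by rewrite /= sumn_nseq mul1n subnK // ltnW.
by apply: LRnz; rewrite -(hookS_vperm A fit) qS0.
Qed.
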